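(* Let $n\ge1$. The family $\Delta^3(\mathbb{A}^n)$ is not isotrivial over $(\mathbb{C}^3)^{\circ}$. In fact, if $m_1,m_2,m_3\in\mathbb{N}$ are distinct and $m_1',m_2',m_3'\in\mathbb{N}$ are distinct, and no rearrangement of the coordinates of $(m_1,m_2,m_3)$ is a (scalar) multiple of $(m_1',m_2',m_3')$, then $$\Delta^3_{(m_1,m_2,m_3)}(\mathbb{A}^n)\not\cong\Delta^3_{(m_1',m_2',m_3')}(\mathbb{A}^n).$$
   Context: $\mathbb{N}$ denotes the positive integers. $(\mathbb{C}^3)^\circ$ is the set of $(m_1,m_2,m_3)\in\mathbb{C}^3$ with $\sum_{i\in S}m_i\ne0$ for every nonempty $S\subset\{1,2,3\}$. Let $e_i(y_1,y_2,y_3,x_1,x_2,x_3)=\sum_{a+b+c=i}\binom{y_1}a\binom{y_2}b\binom{y_3}cx_1^ax_2^bx_3^c$, with $\binom ya=y(y-1)\cdots(y-a+1)/a!$; for vectors $v_1,v_2,v_3\in\mathbb{C}^n$ in place of the $x_i$, products are taken in $\mathrm{Sym}^i\mathbb{C}^n$ (the symmetric power as a vector space). For $N$ sufficiently large the morphism $$(\mathbb{C}^3)^\circ\times(\mathbb{A}^n)^3\to(\mathbb{C}^3)^\circ\times\prod_{i=1}^N\mathrm{Sym}^i\mathbb{C}^n,\quad(m,v)\mapsto\big(m,(e_i(m_1,m_2,m_3,v_1,v_2,v_3))_{1\le i\le N}\big)$$ is finite, and its image (a closed subvariety, with reduced structure) is independent of $N$ up to the coordinate projections, which are isomorphisms.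 This image is $\Delta^3(\mathbb{A}^n)$, a variety over $(\mathbb{C}^3)^\circ$; its reduced fiber over $P$ is $\Delta^3_P(\mathbb{A}^n)$. For $P=(m_1,m_2,m_3)\in\mathbb{N}^3$, $\Delta^3_P(\mathbb{A}^n)$ is the closed subvariety (reduced) of $\mathrm{Sym}^{m_1+m_2+m_3}\mathbb{A}^n=(\mathbb{A}^n)^{m_1+m_2+m_3}/S_{m_1+m_2+m_3}$ of zero-cycles $m_1v_1+m_2v_2+m_3v_3$ with $v_1,v_2,v_3\in\mathbb{A}^n$. A family is called isotrivial if its (reduced) fibers over the points of some nonempty Zariski-open subset of the base are all isomorphic to each other. *)

(* Defs.v *)
From HB Require Import structures.
From mathcomp Require Import all_boot all_order all_algebra all_fingroup.
From mathcomp Require Import boolp classical_sets reals.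
From mathcomp Require Import complex mpoly.

Set Implicit Arguments.
Unset Strict Implicit.
Unset Printing Implicit Defensive.

Import GRing.Theory.

Local Open Scope ring_scope.
Local Open Scope classical_set_scope.

(* A point of the affine space A^k over a field F is a row vector 'rV[F]_k,
   and a reduced subvariety of A^k is given by its set of points. *)

Section Varieties.
Variable F : fieldType.

Definition regular_map (k l : nat) (f : 'I_l -> {mpoly F[k]}) (x : 'rV[F]_k) :
  'rV[F]_l := \row_j (f j).@[x 0].

(* Isomorphism of reduced closed subvarieties X of A^k and Y of A^l: morphisms
   between them are the restrictions of polynomial maps of the ambient spaces. *)
Definition isomorphic (k l : nat) (X : set 'rV[F]_k) (Y : set 'rV[F]_l) : Prop :=
  exists (f : 'I_l -> {mpoly F[k]}) (g : 'I_k -> {mpoly F[l]}),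
    [/\ forall x, X x -> Y (regular_map f x),
        forall y, Y y -> X (regular_map g y),
        forall x, X x -> regular_map g (regular_map f x) = x
      & forall y, Y y -> regular_map f (regular_map g y) = y].

Definition zariski_open_in (b : nat) (B U : set 'rV[F]_b) : Prop :=
  exists S : set {mpoly F[b]},
    U = B `&` [set x | exists2 p, S p & p.@[x 0] != 0].

Definition fiber (b k : nat) (X : set ('rV[F]_b * 'rV[F]_k)) (P : 'rV[F]_b) :
  set 'rV[F]_k := [set y | X (P, y)].

Definition isotrivial (b k : nat) (B : set 'rV[F]_b)
    (X : set ('rV[F]_b * 'rV[F]_k)) : Prop :=
  exists U : set 'rV[F]_b,
    [/\ zariski_open_in B U, U !=set0
      & forall P Q, U P -> U Q -> isomorphic (fiber X P) (fiber X Q)].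

End Varieties.

Section Delta.
Variable R : realType.
Local Notation C := R[i].

Definition gbinom (y : C) (a : nat) : C :=
  (\prod_(j < a) (y - j%:R)) / a`!%:R.

Definition esym (A : comAlgType C) (i : nat) (y1 y2 y3 : C) (x1 x2 x3 : A) : A :=
  \sum_(a < i.+1) \sum_(b < i.+1) \sum_(c < i.+1 | (a + b + c == i)%N)
    (gbinom y1 a * gbinom y2 b * gbinom y3 c) *: (x1 ^+ a * x2 ^+ b * x3 ^+ c).

(* The base: triples none of whose nonempty subsums vanishes. *)
Definition C3o : set 'rV[C]_3 :=
  [set m | forall S : {set 'I_3}, S != finset.set0 -> \sum_(j in S) m 0 j != 0].

(* Sym^i C^n is the space of homogeneous polynomials of degree i in
   n variables; a vector of C^n = Sym^1 C^n is a linear form. *)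
Definition linform (n : nat) (v : 'rV[C]_n) : {mpoly C[n]} :=
  \sum_(k < n) v 0 k *: 'X_k.

Definition esym_vec (n i : nat) (m : 'rV[C]_3) (v : 'I_3 -> 'rV[C]_n) :
  {mpoly C[n]} :=
  esym i (m 0 0) (m 0 1) (m 0 2)
    (linform (v 0)) (linform (v 1)) (linform (v 2)).

(* The monomials of degree 1, ..., N form a basis of the product of the
   Sym^i C^n for 1 <= i <= N. *)
Definition symprod_basis (n N : nat) : finType :=
  {mu : 'X_{1..n < N.+1} | mdeg mu != 0%N}.

Definition symprod_mnm (n N : nat) (j : 'I_#|symprod_basis n N|) : 'X_{1..n} :=
  bmnm (val (enum_val j)).

(* The coordinates of (e_i(m, v))_(1 <= i <= N) in that basis. *)
Definition esym_point (n N : nat) (m : 'rV[C]_3) (v : 'I_3 -> 'rV[C]_n) :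
  'rV[C]_(#|symprod_basis n N|) :=
  \row_j (esym_vec (mdeg (symprod_mnm j)) m v)@_(symprod_mnm j).

(* For N large enough (depending on n only) this image is closed and
   is the total space of the family Delta^3(A^n). *)
Definition Delta3 (n N : nat) :
  set ('rV[C]_3 * 'rV[C]_(#|symprod_basis n N|)) :=
  [set x | exists m v, C3o m /\ x = (m, esym_point N m v)].

Definition natpoint (m : 'I_3 -> nat) : 'rV[C]_3 := \row_j (m j)%:R.

Lemma linform_homog (n : nat) (v : 'rV[C]_n) : linform v \is 1.-homog.
Proof. by apply: rpred_sum => k _; rewrite rpredZ // dhomogX; apply/eqP; exact: mdeg1. Qed.

Lemma esym_vec_homog (n i : nat) (m : 'rV[C]_3) (v : 'I_3 -> 'rV[C]_n) :
  esym_vec i m v \is i.-homog.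
Proof.
have H (x : 'rV[C]_n) k : linform x ^+ k \is k.-homog.
  elim: k => [|k IH]; first by rewrite expr0 dhomog1.
  by rewrite exprS -[k.+1]/(1 + k)%N dhomogM ?linform_homog.
apply: rpred_sum => a _; apply: rpred_sum => b _; apply: rpred_sum => c /eqP abc.
have := dhomogM (dhomogM (H (v 0) a) (H (v 1) b)) (H (v 2) c).
by rewrite abc; apply: rpredZ.
Qed.

Lemma natpoint_C3o (m : 'I_3 -> nat) : (forall j, 0 < m j)%N -> C3o (natpoint m).
Proof.
move=> m0 S /set0Pn[j jS].
under eq_bigr do rewrite mxE.
by rewrite -natr_sum Num.Theory.pnatr_eq0 (bigD1 j) //= addn_eq0 negb_and -lt0n m0.
Qed.

End Delta.

(* Main.v *)
(* Passing from the [e_i] to the weighted power sums (Newton's identities), the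
   fiber over [m] is the image of the [3 x n] matrices [x] under the power sums
   [\sum_k m_k <x_k, u> ^ i].  When the [m_k] are distinct, the rows [x_k] are
   rational functions of these sums, and they are integral over them because no
   subsum of the [m_k] vanishes; hence an isomorphism of fibers lifts to a
   polynomial automorphism [phi] of the space of matrices.  The differential of
   the power sums is injective off the diagonals [x_i = x_j], and at a generic
   point of [x_i = x_j] its kernel is [m_i v_i + m_j v_j = 0, v_k = 0].  So [phi]
   permutes the diagonals and its differential at [0] respects both the diagonals
   and these kernels, which determine the ratios of the [m_k] up to a permutation. *)

Require Import Defs.
From HB Require Import structures.
From mathcomp Require Import all_boot all_order all_algebra all_fingroup.
From mathcomp Require Import boolp classical_sets reals.
From mathcomp Require Import complex mpoly.
From mathcomp Require Import ring zify.

Set Implicit Arguments.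
Unset Strict Implicit.
Unset Printing Implicit Defensive.

Import GRing.Theory.
Local Open Scope ring_scope.

(** * Polynomial functions *)

(** The fibers are singular along the images of the diagonals, so morphisms between them are never
    differentiated: composed with the power sums, such a morphism is a polynomial function of the
    matrix, and it sends arcs that are constant to first order to arcs of the same kind. Integral
    closedness of the polynomial ring is replaced by division along all lines through one point,
    where a root of the denominator is a common root of the numerators. The differential is taken at
    [0] because every diagonal is a linear subspace; but at [0] the higher power sums add nothing to
    the first one, and the missing relation is carried there by density from generic points of each
    diagonal. The bound 5 is the degree up to which moments are used to determine three points with
    distinct weights. *)

Lemma coef1M (A : nzRingType) (p q : {poly A}) : (p * q)`_1 = p`_0 * q`_1 + p`_1 * q`_0.
Proof. by rewrite coefM big_ord_recl big_ord1. Qed.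

Lemma coef1X (A : comNzRingType) (p : {poly A}) k :
  (p ^+ k.+1)`_1 = (p`_0 ^+ k * p`_1) *+ k.+1.
Proof.
elim: k => [|k IH]; first by rewrite expr0 mul1r mulr1n.
have X0 : (p ^+ k.+1)`_0 = p`_0 ^+ k.+1.
  by elim: k {IH} => // k IH; rewrite exprS coef0M IH -exprS.
by rewrite exprS coef1M IH X0 [in RHS]mulrS [in RHS]exprS -mulr_natl exprS; ring.
Qed.

Section PolynomialFunctions.
Variable F : numFieldType.

Lemma poly_nat_eq0 (p : {poly F}) : (forall k : nat, p.[k%:R] = 0) -> p = 0.
Proof.
move=> p0; apply/eqP/negPn/negP => nz.
have /(max_poly_roots nz) : all (root p) [seq k%:R | k <- iota 0 (size p)].
  by apply/allP => _ /mapP[k _ ->]; rewrite rootE p0.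
rewrite size_map size_iota ltnn map_inj_uniq ?iota_uniq; first by move/(_ isT).
by move=> k l /eqP; rewrite Num.Theory.eqr_nat => /eqP.
Qed.

Lemma poly_ext (p q : {poly F}) : (forall t, p.[t] = q.[t]) -> p = q.
Proof.
move=> pq; apply/eqP; rewrite -subr_eq0; apply/eqP/poly_nat_eq0 => k.
by rewrite hornerD hornerN pq subrr.
Qed.

Definition is_poly (f : F -> F) := exists p : {poly F}, forall t, f t = p.[t].

(** A total choice with default value 0, so that [line] makes sense for every function; uniqueness
    is [poly_ext]. *)
Definition polyof (f : F -> F) : {poly F} :=
  xget 0 [set p : {poly F} | forall t, f t = p.[t]]%classic.

Lemma polyofE (f : F -> F) (p : {poly F}) : (forall t, f t = p.[t]) -> polyof f = p.
Proof.
move=> fp; apply: xget_unique => // q fq.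
by apply: poly_ext => t; rewrite -fp -fq.
Qed.

Lemma polyofP (f : F -> F) : is_poly f -> forall t, f t = (polyof f).[t].
Proof. by move=> [p fp] t; rewrite (polyofE fp). Qed.

Lemma is_polyD (f g : F -> F) : is_poly f -> is_poly g -> is_poly (fun t => f t + g t).
Proof. by move=> [p fp] [q gq]; exists (p + q) => t; rewrite hornerD fp gq. Qed.

Lemma is_polyM (f g : F -> F) : is_poly f -> is_poly g -> is_poly (fun t => f t * g t).
Proof. by move=> [p fp] [q gq]; exists (p * q) => t; rewrite hornerM fp gq. Qed.

(* [f] is a polynomial congruent to a constant modulo [t ^ 2]. *)
Definition flat (f : F -> F) :=
  exists p : {poly F}, (forall t, f t = p.[t]) /\ p`_1 = 0.

Lemma flat_cst (c : F) : flat (fun=> c).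
Proof. by exists c%:P; split=> [t|]; rewrite ?hornerC ?coefC. Qed.

Lemma flatD (f g : F -> F) : flat f -> flat g -> flat (fun t => f t + g t).
Proof.
move=> [p [fp p1]] [q [gq q1]]; exists (p + q).
by split=> [t|]; rewrite ?hornerD ?fp ?gq // coefD p1 q1 addr0.
Qed.

Lemma flatM (f g : F -> F) : flat f -> flat g -> flat (fun t => f t * g t).
Proof.
move=> [p [fp p1]] [q [gq q1]]; exists (p * q).
by split=> [t|]; rewrite ?hornerM ?fp ?gq // coef1M p1 q1 mulr0 mul0r addr0.
Qed.

Lemma flat_coef1 (f : F -> F) (p : {poly F}) :
  flat f -> (forall t, f t = p.[t]) -> p`_1 = 0.
Proof. by move=> [q [fq q1]] fp; rewrite (poly_ext (p := p) (q := q)) // => t; rewrite -fp. Qed.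

(** A predicate on functions rather than elements of [mpoly]: composition and restriction to lines
    become inductions, and matrices of all shapes are treated alike. *)
Inductive polyfun (a b : nat) : ('M[F]_(a, b) -> F) -> Prop :=
| polyfun_cst c : polyfun (fun=> c)
| polyfun_coord i j : polyfun (fun x => x i j)
| polyfunD g h : polyfun g -> polyfun h -> polyfun (fun x => g x + h x)
| polyfunM g h : polyfun g -> polyfun h -> polyfun (fun x => g x * h x).

Lemma eq_polyfun (a b : nat) (g h : 'M[F]_(a, b) -> F) : g =1 h -> polyfun g -> polyfun h.
Proof. by move=> /funext ->. Qed.

Lemma polyfunN (a b : nat) (h : 'M[F]_(a, b) -> F) : polyfun h -> polyfun (fun x => - h x).
Proof.
move=> ph; apply: (eq_polyfun (g := fun x => -1 * h x)); first by move=> x; rewrite mulN1r.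
by apply: polyfunM => //; apply: polyfun_cst.
Qed.

Lemma polyfunB (a b : nat) (g h : 'M[F]_(a, b) -> F) :
  polyfun g -> polyfun h -> polyfun (fun x => g x - h x).
Proof. by move=> pg ph; apply: polyfunD => //; apply: polyfunN. Qed.

Lemma polyfunX (a b k : nat) (h : 'M[F]_(a, b) -> F) :
  polyfun h -> polyfun (fun x => h x ^+ k).
Proof.
move=> ph; elim: k => [|k IH].
  by apply: (eq_polyfun (g := fun=> 1)); [move=> x; rewrite expr0 | apply: polyfun_cst].
by apply: (eq_polyfun (g := fun x => h x * h x ^+ k)) => [x|]; [rewrite exprS | apply: polyfunM].
Qed.

Lemma polyfun_sum (a b : nat) (I : Type) (r : seq I) (P : pred I)
    (h : I -> 'M[F]_(a, b) -> F) :
  (forall i, P i -> polyfun (h i)) -> polyfun (fun x => \sum_(i <- r | P i) h i x).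
Proof.
move=> ph; elim: r => [|i r IH].
  by apply: (eq_polyfun (g := fun=> 0)); [move=> x; rewrite big_nil | apply: polyfun_cst].
case Pi: (P i); last first.
  by apply: eq_polyfun IH => x; rewrite big_cons Pi.
apply: (eq_polyfun (g := fun x => h i x + \sum_(i <- r | P i) h i x)).
  by move=> x; rewrite big_cons Pi.
by apply: polyfunD => //; apply: ph.
Qed.

Lemma polyfun_prod (a b : nat) (I : Type) (r : seq I) (h : I -> 'M[F]_(a, b) -> F) :
  (forall i, polyfun (h i)) -> polyfun (fun x => \prod_(i <- r) h i x).
Proof.
move=> ph; elim: r => [|i r IH].
  by apply: (eq_polyfun (g := fun=> 1)); [move=> x; rewrite big_nil | apply: polyfun_cst].
apply: (eq_polyfun (g := fun x => h i x * \prod_(i <- r) h i x)).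
  by move=> x; rewrite big_cons.
exact: polyfunM.
Qed.

Lemma polyfun_comp (a b c d : nat) (h : 'M[F]_(a, b) -> F) (f : 'M[F]_(c, d) -> 'M[F]_(a, b)) :
  polyfun h -> (forall i j, polyfun (fun x => f x i j)) -> polyfun (fun x => h (f x)).
Proof.
move=> ph pf; elim: ph => {h} [e|i j|g h _ IHg _ IHh|g h _ IHg _ IHh] //.
- exact: polyfun_cst.
- exact: polyfunD.
- exact: polyfunM.
Qed.

Lemma polyfun_meval (k : nat) (p : {mpoly F[k]}) : polyfun (fun x : 'rV[F]_k => p.@[x 0]).
Proof.
elim/mpolyind: p => [|c mu p _ _ IH].
  by apply: (eq_polyfun (g := fun=> 0)); [move=> x; rewrite meval0 | apply: polyfun_cst].
apply: (eq_polyfun (g := fun x => c * (\prod_(i < k) x 0 i ^+ mu i) + p.@[x 0])).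
  by move=> x; rewrite mevalD mevalZ mevalX.
apply: polyfunD => //; apply: polyfunM; first exact: polyfun_cst.
by apply: polyfun_prod => i; apply: polyfunX; apply: polyfun_coord.
Qed.

Lemma flat_comp (a b : nat) (h : 'M[F]_(a, b) -> F) (f : F -> 'M[F]_(a, b)) :
  polyfun h -> (forall i j, flat (fun t => f t i j)) -> flat (fun t => h (f t)).
Proof.
move=> ph pf; elim: ph => {h} [e|i j|g h _ IHg _ IHh|g h _ IHg _ IHh] //.
- exact: flat_cst.
- exact: flatD.
- exact: flatM.
Qed.

(** The coefficient of degree 1 serves as the directional derivative of [h] at [x] along [v]. *)
Definition line (a b : nat) (h : 'M[F]_(a, b) -> F) (x v : 'M[F]_(a, b)) : {poly F} :=
  polyof (fun t => h (x + t *: v)).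

Lemma lineE (a b : nat) (h : 'M[F]_(a, b) -> F) (p : {poly F}) x v :
  (forall t, h (x + t *: v) = p.[t]) -> line h x v = p.
Proof. exact: polyofE. Qed.

Lemma lineP (a b : nat) (h : 'M[F]_(a, b) -> F) : polyfun h ->
  forall x v t, h (x + t *: v) = (line h x v).[t].
Proof.
move=> ph x v; apply: polyofP.
elim: ph => {h} [e|i j|g h _ IHg _ IHh|g h _ IHg _ IHh].
- by exists e%:P => t; rewrite hornerC.
- exists ((x i j)%:P + v i j *: 'X) => t.
  by rewrite !mxE hornerD hornerC hornerZ hornerX mulrC.
- exact: is_polyD.
- exact: is_polyM.
Qed.

Lemma line_cst (a b : nat) (c : F) (x v : 'M[F]_(a, b)) : line (fun=> c) x v = c%:P.
Proof. by apply: lineE => t; rewrite hornerC. Qed.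

Lemma line_coord (a b : nat) i j (x v : 'M[F]_(a, b)) :
  line (fun x => x i j) x v = (x i j)%:P + v i j *: 'X.
Proof. by apply: lineE => t; rewrite !mxE hornerD hornerC hornerZ hornerX mulrC. Qed.

Lemma lineD (a b : nat) (g h : 'M[F]_(a, b) -> F) x v : polyfun g -> polyfun h ->
  line (fun x => g x + h x) x v = line g x v + line h x v.
Proof. by move=> pg ph; apply: lineE => t; rewrite hornerD !lineP. Qed.

Lemma lineM (a b : nat) (g h : 'M[F]_(a, b) -> F) x v : polyfun g -> polyfun h ->
  line (fun x => g x * h x) x v = line g x v * line h x v.
Proof. by move=> pg ph; apply: lineE => t; rewrite hornerM !lineP. Qed.

Lemma line_coef0 (a b : nat) (h : 'M[F]_(a, b) -> F) x v :
  polyfun h -> (line h x v)`_0 = h x.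
Proof. by move=> ph; rewrite -horner_coef0 -lineP // scale0r addr0. Qed.

(** The uniformity of [M] in [v] makes the quotient built in [polyfun_dvd_power_sums] a finite
    sum. *)
Lemma line_size_bounded (a b : nat) (h : 'M[F]_(a, b) -> F) : polyfun h ->
  exists M, forall x v, (size (line h x v) <= M)%N.
Proof.
elim=> {h} [e|i j|g h pg [M HM] ph [M' HM']|g h pg [M HM] ph [M' HM']].
- by exists 1 => x v; rewrite line_cst size_polyC_leq1.
- exists 2 => x v; rewrite line_coord.
  rewrite (leq_trans (size_polyD _ _)) // geq_max (leq_trans (size_polyC_leq1 _)) //.
  by rewrite (leq_trans (size_scale_leq _ _)) // size_polyX.
- exists (maxn M M') => x v; rewrite lineD // (leq_trans (size_polyD _ _)) //.
  by rewrite geq_max !leq_max HM HM' orbT.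
- exists (M + M')%N => x v; rewrite lineM // (leq_trans (size_polyMleq _ _)) //.
  by rewrite (leq_trans (leq_pred _)) // leq_add.
Qed.

Lemma polyfun_line_coef (a b : nat) (h : 'M[F]_(a, b) -> F) x j :
  polyfun h -> polyfun (fun v => (line h x v)`_j).
Proof.
move=> ph; elim: ph j => {h} [e|i k|g h pg IHg ph IHh|g h pg IHg ph IHh] j.
- by apply: eq_polyfun (polyfun_cst _ _ (e%:P`_j)) => v; rewrite line_cst.
- apply: (eq_polyfun (g := fun v => (x i k)%:P`_j + v i k * 'X`_j)).
    by move=> v; rewrite line_coord coefD coefZ.
  apply: polyfunD; first exact: polyfun_cst.
  by apply: polyfunM; [apply: polyfun_coord | apply: polyfun_cst].
- by apply: eq_polyfun (polyfunD (IHg j) (IHh j)) => v; rewrite lineD // coefD.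
- apply: (eq_polyfun (g := fun v => \sum_(i < j.+1) (line g x v)`_i * (line h x v)`_(j - i))).
    by move=> v; rewrite lineM // coefM.
  by apply: polyfun_sum => i _; apply: polyfunM.
Qed.

Lemma polyfun_dline (a b : nat) (h : 'M[F]_(a, b) -> F) v :
  polyfun h -> polyfun (fun x => (line h x v)`_1).
Proof.
elim=> {h} [e|i k|g h pg IHg ph IHh|g h pg IHg ph IHh].
- by apply: eq_polyfun (polyfun_cst _ _ 0) => x; rewrite line_cst coefC.
- apply: eq_polyfun (polyfun_cst _ _ (v i k)) => x.
  by rewrite line_coord coefD coefC coefZ coefX add0r mulr1.
- by apply: eq_polyfun (polyfunD IHg IHh) => x; rewrite lineD // coefD.
- apply: eq_polyfun (polyfunD (polyfunM pg IHh) (polyfunM IHg ph)) => x.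
  by rewrite lineM // coef1M !line_coef0.
Qed.

Lemma dline_linear (a b : nat) (h : 'M[F]_(a, b) -> F) x c u v : polyfun h ->
  (line h x (c *: u + v))`_1 = c * (line h x u)`_1 + (line h x v)`_1.
Proof.
elim=> {h} [e|i k|g h pg IHg ph IHh|g h pg IHg ph IHh].
- by rewrite !line_cst !coefC mulr0 addr0.
- by rewrite !line_coord !coefD !coefC !coefZ !coefX !mulr1 !add0r !mxE.
- by rewrite !lineD // !coefD IHg IHh; ring.
- by rewrite !lineM // !coef1M IHg IHh !line_coef0 //; ring.
Qed.

(* Restricting to the line through [x] and [y] reduces to univariate polynomials. *)
Lemma polyfun_domain (a b : nat) (g h : 'M[F]_(a, b) -> F) x y :
  polyfun g -> polyfun h -> g x != 0 -> h y != 0 -> exists z, g z != 0 /\ h z != 0.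
Proof.
move=> pg ph gx hy; apply: contrapT => H.
suff : line g x (y - x) * line h x (y - x) = 0.
  move/eqP; rewrite mulf_eq0 => /orP[] /eqP E0.
    by move/eqP: gx; apply; rewrite -(line_coef0 x (y - x)) // E0 coef0.
  move/eqP: hy; apply; have := lineP ph x (y - x) 1.
  by rewrite E0 horner0 scale1r addrC subrK.
apply: poly_ext => t; rewrite hornerM horner0 -!lineP //; apply: contrapT => /eqP.
by rewrite mulf_eq0 negb_or => /andP[? ?]; apply: H; exists (x + t *: (y - x)).
Qed.

Lemma polyfun_prod_neq0 (a b : nat) (I : Type) (r : seq I) (h : I -> 'M[F]_(a, b) -> F) :
  (forall i, polyfun (h i)) -> (forall i, exists x, h i x != 0) ->
  exists x, \prod_(i <- r) h i x != 0.
Proof.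
move=> ph nz; elim: r => [|i r [x IH]].
  by exists 0; rewrite big_nil oner_eq0.
have [y hy] := nz i.
have [z [hz rz]] := polyfun_domain (ph i) (polyfun_prod r ph) hy IH.
by exists z; rewrite big_cons mulf_neq0.
Qed.

Lemma polyfun_ext_dense (a b : nat) (d g h : 'M[F]_(a, b) -> F) x0 :
  polyfun d -> polyfun g -> polyfun h -> d x0 != 0 ->
  (forall x, d x != 0 -> g x = h x) -> g =1 h.
Proof.
move=> pd pg ph dx0 gh x; apply/eqP; rewrite -subr_eq0; apply/negPn/negP => nz.
have [z [dz]] := polyfun_domain pd (polyfunB pg ph) dx0 nz.
by rewrite gh // subrr eqxx.
Qed.

End PolynomialFunctions.

(** * Three points determined by weighted power sums *)

Lemma ord3E :
  [/\ 0 + 1 = 1 :> 'I_3, 0 + 2 = 2 :> 'I_3, 1 + 1 = 2 :> 'I_3, 1 + 2 = 0 :> 'I_3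
    & 2 + 1 = 0 :> 'I_3 /\ 2 + 2 = 1 :> 'I_3].
Proof. by split; [..|split]; apply: val_inj. Qed.

Lemma ord3P (P : 'I_3 -> Prop) : P 0 -> P 1 -> P 2 -> forall k, P k.
Proof.
move=> P0 P1 P2 [[|[|[|k]]] lt_k3] //; [move: P0|move: P1|move: P2];
  by congr P; apply: val_inj.
Qed.

Lemma sum_ord3 (V : nmodType) (f : 'I_3 -> V) k : \sum_i f i = f k + f (k + 1) + f (k + 2).
Proof.
have E : \sum_i f i = f 0 + f 1 + f 2.
  rewrite !big_ord_recl big_ord0 addr0 addrA; congr (_ + f _ + f _); exact: val_inj.
have [e01 e02 e11 e12 [e21 e22]] := ord3E; elim/ord3P: k.
- by rewrite e01 e02.
- by rewrite e11 e12 E -addrA addrC.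
- by rewrite e21 e22 E addrC addrA.
Qed.

Lemma ord3_neq (k : 'I_3) : [/\ k != k + 1, k != k + 2 & k + 1 != k + 2].
Proof. by elim/ord3P: k. Qed.

Lemma ord3_cover (c i : 'I_3) : [|| i == c, i == c + 1 | i == c + 2].
Proof. by elim/ord3P: c; elim/ord3P: i. Qed.

Section PowerSums.
Variable F : numClosedFieldType.

Lemma two_power_sums_eq0 (a b y z : F) : a != 0 -> b != 0 -> a + b != 0 ->
  a * y + b * z = 0 -> a * y ^+ 2 + b * z ^+ 2 = 0 -> y = 0 /\ z = 0.
Proof.
move=> a0 b0 ab0 e1 e2.
have : a * y * (y - z) = 0.
  have -> : a * y * (y - z) = (a * y ^+ 2 + b * z ^+ 2) - z * (a * y + b * z) by ring.
  by rewrite e1 e2 mulr0 subr0.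
move/eqP; rewrite -mulrA !mulf_eq0 (negbTE a0) subr_eq0 /= => /orP[/eqP y0|/eqP yz].
  split=> //; move/eqP: e1; rewrite y0 mulr0 add0r mulf_eq0 (negbTE b0) /=.
  by move/eqP.
move/eqP: e1; rewrite yz -mulrDl mulf_eq0 (negbTE ab0) /= => /eqP.
by split.
Qed.

(** Combining the three sums with the coefficients of [T (T - q) (T - r)] isolates
    [a * p * (p - q) * (p - r)]. So [p] is zero or meets another value; the two weights then merge
    into a nonzero one, and two points remain. *)
Lemma power_sums_eq0 (w y : 'I_3 -> F) : (forall k, 0 < w k) ->
  (forall i, (0 < i <= 3)%N -> \sum_k w k * y k ^+ i = 0) -> forall k, y k = 0.
Proof.
move=> w0 S k; have nz j : w j != 0 by rewrite Num.Theory.lt0r_neq0.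
have nz2 i j : w i + w j != 0 by rewrite Num.Theory.lt0r_neq0 // Num.Theory.addr_gt0.
have nz3 : w k + w (k + 1) + w (k + 2) != 0.
  by rewrite Num.Theory.lt0r_neq0 // !Num.Theory.addr_gt0.
have := S 1%N isT; have := S 2%N isT; have := S 3%N isT.
rewrite !(sum_ord3 _ k); move: nz3 (nz2 k (k + 1)) (nz2 k (k + 2)) (nz k) (nz (k + 1)) (nz (k + 2)).
move: (w k) (w (k + 1)) (w (k + 2)) (y k) (y (k + 1)) (y (k + 2)) => a b c p q r.
move=> abc0 ab0 ac0 a0 b0 c0 e3 e2 e1.
have : a * p * (p - q) * (p - r) = 0.
  have -> : a * p * (p - q) * (p - r) = (a * p ^+ 3 + b * q ^+ 3 + c * r ^+ 3)
     - (q + r) * (a * p ^+ 2 + b * q ^+ 2 + c * r ^+ 2)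
     + q * r * (a * p ^+ 1 + b * q ^+ 1 + c * r ^+ 1).
    by ring.
  by rewrite e1 e2 e3; ring.
move/eqP; rewrite !mulf_eq0 (negbTE a0) !subr_eq0 /= => /orP[/orP[/eqP//|/eqP pq]|/eqP pr].
  apply: proj1 (two_power_sums_eq0 (a := a + b) (b := c) (z := r) _ _ _ _ _) => //.
    by rewrite -e1 -pq; ring.
  by rewrite -e2 -pq; ring.
apply: proj1 (two_power_sums_eq0 (a := a + c) (b := b) (z := q) _ _ _ _ _) => //.
- by rewrite addrAC.
- by rewrite -e1 -pr; ring.
- by rewrite -e2 -pr; ring.
Qed.

(** At a root [c] of [d] all three power sums vanish, hence so does every [r k]. Cancelling the
    factor ['X - c%:P] everywhere lowers the size of [d]. *)
Lemma poly_dvd_power_sums (w : 'I_3 -> F) (d : {poly F}) (r : 'I_3 -> {poly F}) :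
  (forall k, 0 < w k) -> d != 0 ->
  (forall i, (0 < i <= 3)%N -> d ^+ i %| \sum_k w k *: r k ^+ i) -> forall k, d %| r k.
Proof.
move=> w0; have [n le_dn] := ubnP (size d).
elim: n d r le_dn => // n IH d r le_dn d0 dvd k.
have [d1|d1] := eqVneq (size d) 1%N.
  by apply: (dvdp_trans (y := 1)); rewrite ?dvd1p // dvdp1 d1.
have [c dc] := closed_rootP d d1.
have rc j : root (r j) c.
  apply/rootP; apply: (power_sums_eq0 (w := w) (y := fun j => (r j).[c])) => // i i3.
  rewrite (eq_bigr (fun k => (w k *: r k ^+ i).[c])) => [|l _]; last first.
    by rewrite hornerZ horner_exp.
  rewrite -horner_sum; apply/rootP; rewrite root_factor_theorem.
  apply: dvdp_trans (dvd i i3); case: i i3 => // i _.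
  by rewrite exprS dvdp_mulr // -root_factor_theorem.
have /factor_theorem[d' dE] := dc.
have {rc} rE j : {s | r j = s * ('X - c%:P)}.
  by apply/cid; have /factor_theorem[s ->] := rc j; exists s.
have d'0 : d' != 0 by apply: contraNneq d0 => d'0; rewrite dE d'0 mul0r.
have X0 : 'X - c%:P != 0 :> {poly F} by rewrite polyXsubC_eq0.
rewrite dE (svalP (rE k)) dvdp_mul2r //.
apply: (IH d' (fun j => sval (rE j))) => // [|i i3].
  by move: le_dn; rewrite dE size_Mmonic ?monicXsubC // size_XsubC addn2.
have := dvd i i3; rewrite dE exprMn.
rewrite (eq_bigr (fun j => (w j *: sval (rE j) ^+ i) * ('X - c%:P) ^+ i)) => [|j _].
  by rewrite -mulr_suml dvdp_mul2r // expf_neq0.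
by rewrite {1}(svalP (rE j)) exprMn scalerAl.
Qed.

(* The quotients are polynomial along every line through [x0]; their coefficients
   there depend polynomially on the direction and vanish beyond a fixed degree. *)
Lemma polyfun_dvd_power_sums (a b : nat) (w : 'I_3 -> F) (d : 'M[F]_(a, b) -> F)
    (r : 'I_3 -> 'M[F]_(a, b) -> F) (q : nat -> 'M[F]_(a, b) -> F) x0 :
  (forall k, 0 < w k) -> polyfun d -> (forall k, polyfun (r k)) ->
  (forall i, (0 < i <= 3)%N -> polyfun (q i)) -> d x0 != 0 ->
  (forall i, (0 < i <= 3)%N -> forall x, \sum_k w k * r k x ^+ i = q i x * d x ^+ i) ->
  forall k, exists g, polyfun g /\ forall x, r k x = d x * g x.
Proof.
move=> w0 pd pr pq dx0 S k.
have ld0 v : line d x0 v != 0.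
  by apply: contraNneq dx0 => E; rewrite -(line_coef0 x0 v pd) E coef0.
pose c v := line (r k) x0 v %/ line d x0 v.
have rE v : line (r k) x0 v = c v * line d x0 v.
  rewrite divpK //; apply: (poly_dvd_power_sums (r := fun k => line (r k) x0 v) w0) => // i i3.
  apply/dvdpP; exists (line (q i) x0 v); apply: poly_ext => t.
  rewrite hornerM horner_exp horner_sum -!lineP //; last exact: pq.
  by rewrite -S //; apply: eq_bigr => j _; rewrite hornerZ horner_exp -lineP.
have [M leM] := line_size_bounded (pr k).
have pc j : polyfun (fun v => (c v)`_j).
  (* Division of power series: the constant coefficient of [line d x0 v] is [d x0], a nonzero number
     independent of [v], so nothing else is inverted. *)
  have [n] := ubnP j; elim: n j => // n IH j /ltnSE le_jn.
  apply: (eq_polyfun (g := fun v => (d x0)^-1 *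
     ((line (r k) x0 v)`_j - \sum_(i < j) (c v)`_i * (line d x0 v)`_(j - i)))).
    move=> v; rewrite rE coefM big_ord_recr /= subnn line_coef0 // addrAC subrr add0r.
    by rewrite mulrC mulfK.
  apply: polyfunM; first exact: polyfun_cst.
  apply: polyfunB; first exact: polyfun_line_coef.
  apply: polyfun_sum => i _; apply: polyfunM; last exact: polyfun_line_coef.
  by apply: IH; apply: leq_trans le_jn.
exists (fun x => \sum_(j < M) (c (x - x0))`_j); split=> [|x].
  apply: polyfun_sum => j _; apply: (polyfun_comp (pc j)) => i l.
  apply: (eq_polyfun (g := fun x => x i l - x0 i l)) => [x|]; first by rewrite !mxE.
  by apply: polyfunB; [apply: polyfun_coord | apply: polyfun_cst].
have xE : x = x0 + 1 *: (x - x0) by rewrite scale1r addrC subrK.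
rewrite {1 2}xE !lineP // rE hornerM mulrC; congr (_ * _).
rewrite (horner_coef_wide (n := M)) => [|].
  by apply: eq_bigr => j _; rewrite expr1n mulr1.
apply: leq_trans (leM x0 (x - x0)); rewrite rE.
have [->|c0] := eqVneq (c (x - x0)) 0; first by rewrite size_poly0.
by rewrite size_mul // -(prednK (n := size (line d _ _))) ?size_poly_gt0 // addnS leq_addr.
Qed.

End PowerSums.

(** * Rational recovery of three points from their moments *)

Section Localization.
Variables (F : numFieldType) (a b : nat) (D : 'M[F]_(a, b) -> F).

(** Where [D] vanishes, a positive power of [D] leaves [h] unconstrained; this tolerates functions
    obtained by an arbitrary choice of preimages. *)
Definition localized (h : 'M[F]_(a, b) -> F) := exists n, polyfun (fun x => D x ^+ n * h x).

Lemma eq_localized (g h : 'M[F]_(a, b) -> F) : g =1 h -> localized g -> localized h.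
Proof. by move=> /funext ->. Qed.

Lemma localized_polyfun (h : 'M[F]_(a, b) -> F) : polyfun h -> localized h.
Proof. by exists 0%N; apply: eq_polyfun H => x; rewrite expr0 mul1r. Qed.

Hypothesis pD : polyfun D.

Lemma localizedM (g h : 'M[F]_(a, b) -> F) :
  localized g -> localized h -> localized (fun x => g x * h x).
Proof.
move=> [n gn] [m hm]; exists (n + m)%N; apply: eq_polyfun (polyfunM gn hm) => x.
by rewrite exprD mulrACA.
Qed.

Lemma localizedD (g h : 'M[F]_(a, b) -> F) :
  localized g -> localized h -> localized (fun x => g x + h x).
Proof.
move=> [n gn] [m hm]; exists (n + m)%N.
apply: eq_polyfun (polyfunD (polyfunM (polyfunX m pD) gn) (polyfunM (polyfunX n pD) hm)) => x.
by rewrite exprD; ring.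
Qed.

Lemma localized_cst c : localized (fun=> c).
Proof. exact/localized_polyfun/polyfun_cst. Qed.

Lemma localizedB (g h : 'M[F]_(a, b) -> F) :
  localized g -> localized h -> localized (fun x => g x - h x).
Proof.
move=> lg lh; apply: (eq_localized (g := fun x => g x + -1 * h x)).
  by move=> x; rewrite mulN1r.
by apply: localizedD lg _; apply: localizedM lh; apply: localized_cst.
Qed.

Lemma localized_div (h : 'M[F]_(a, b) -> F) : localized (fun x => D x * h x) -> localized h.
Proof. by move=> [n hn]; exists n.+1; apply: eq_polyfun hn => x; rewrite exprSr mulrA. Qed.

End Localization.

Section Recovery.
Variables (F : numClosedFieldType) (a b : nat).
Variables (w : 'I_3 -> F) (y : 'I_3 -> 'M[F]_(a, b) -> F).
Implicit Types (u : 'I_3 -> 'M[F]_(a, b) -> F) (x : 'M[F]_(a, b)).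

(** The determinant of the Hankel matrix [q (i + j)] for [i, j < 3]. That matrix is a diagonal
    matrix of weights between a Vandermonde matrix and its transpose, whence [hankel3E]. *)
Definition hankel3 x : F := let q i := \sum_k w k * y k x ^+ i in
  q 0 * (q 2 * q 4 - q 3 * q 3) - q 1 * (q 1 * q 4 - q 3 * q 2)
  + q 2 * (q 1 * q 3 - q 2 * q 2).

Lemma hankel3E x : hankel3 x = w 0 * w 1 * w 2
  * ((y 0 x - y 1 x) * (y 0 x - y 2 x) * (y 1 x - y 2 x)) ^+ 2.
Proof.
have [e01 e02 _ _ _] := ord3E.
by rewrite /hankel3 !(sum_ord3 _ 0) e01 e02; ring.
Qed.

Hypothesis w0 : forall k, 0 < w k.
Hypothesis moments : forall i, (i <= 5)%N -> polyfun (fun x => \sum_k w k * y k x ^+ i).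

Lemma polyfun_hankel3 : polyfun hankel3.
Proof.
by do ![apply: polyfunB | apply: polyfunD | apply: polyfunM | apply: moments].
Qed.

Local Notation loc := (localized hankel3).
Let locM := @localizedM F a b hankel3.
Let locD := localizedD polyfun_hankel3.
Let locB := localizedB polyfun_hankel3.

Let s1 x := y 0 x + y 1 x + y 2 x.
Let s2 x := y 0 x * y 1 x + y 0 x * y 2 x + y 1 x * y 2 x.
Let s3 x := y 0 x * y 1 x * y 2 x.

(* Prony's method: Cramer's rule for the recurrence
   [q (i + 3) = s1 * q (i + 2) - s2 * q (i + 1) + s3 * q i], [i = 0, 1, 2]. *)
Lemma localized_esyms : [/\ loc s1, loc s2 & loc s3].
Proof.
pose q i x := \sum_k w k * y k x ^+ i.
have Lq i : (i <= 5)%N -> loc (q i) by move=> /moments /localized_polyfun; apply.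
have [e01 e02 _ _ _] := ord3E.
split; apply: (localized_div (D := hankel3)).
- apply: (eq_localized (g := fun x => q 0 x * (q 2 x * q 5 x - q 4 x * q 3 x)
    - q 1 x * (q 1 x * q 5 x - q 4 x * q 2 x) + q 3 x * (q 1 x * q 3 x - q 2 x * q 2 x))).
    by move=> x; rewrite hankel3E /q /s1 !(sum_ord3 _ 0) e01 e02; ring.
  by do ![apply: locB | apply: locD | apply: locM | apply: Lq].
- apply: (eq_localized (g := fun x => q 3 x * (q 1 x * q 4 x - q 3 x * q 2 x)
    - q 0 x * (q 4 x * q 4 x - q 3 x * q 5 x) - q 2 x * (q 1 x * q 5 x - q 4 x * q 2 x))).
    by move=> x; rewrite hankel3E /q /s2 !(sum_ord3 _ 0) e01 e02; ring.
  by do ![apply: locB | apply: locD | apply: locM | apply: Lq].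
- apply: (eq_localized (g := fun x => q 3 x * (q 2 x * q 4 x - q 3 x * q 3 x)
    - q 1 x * (q 4 x * q 4 x - q 3 x * q 5 x) + q 2 x * (q 4 x * q 3 x - q 2 x * q 5 x))).
    by move=> x; rewrite hankel3E /q /s3 !(sum_ord3 _ 0) e01 e02; ring.
  by do ![apply: locB | apply: locD | apply: locM | apply: Lq].
Qed.

(** These are the families that may replace the weights in the moments. They are modified below by
    [y k], [diff k] and [w k] until a single node is left. *)
Let good u := forall i, loc (fun x => \sum_k u k x * y k x ^+ i).

(** From degree 6 on, the moments follow from the recurrence of order three with coefficients [s1],
    [s2], [s3]. *)
Lemma good_weights : good (fun k _ => w k).
Proof.
have [l1 l2 l3] := localized_esyms; have [e01 e02 _ _ _] := ord3E.
move=> i; have [n] := ubnP i; elim: n i => // n IH i /ltnSE le_in.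
have [/moments /localized_polyfun|] := leqP i 5; first exact.
case: i le_in => [|[|[|i]]] // le_in _.
have L j : (j < i.+3)%N -> loc (fun x => \sum_k w k * y k x ^+ j).
  by move=> lt_j; apply/IH/(leq_trans lt_j).
apply: (eq_localized (g := fun x => s1 x * (\sum_k w k * y k x ^+ i.+2)
   - s2 x * (\sum_k w k * y k x ^+ i.+1) + s3 x * (\sum_k w k * y k x ^+ i))).
  by move=> x; rewrite /s1 /s2 /s3 !(sum_ord3 _ 0) e01 e02 !exprS; ring.
by do ![apply: locB | apply: locD | apply: locM => //]; apply: L; rewrite // ltnS leqW.
Qed.

Lemma goodD u v : good u -> good v -> good (fun k x => u k x + v k x).
Proof.
move=> gu gv i; apply: eq_localized (locD (gu i) (gv i)) => x.
by rewrite -big_split; apply: eq_bigr => k _; rewrite mulrDl.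
Qed.

Lemma goodM h u : loc h -> good u -> good (fun k x => h x * u k x).
Proof.
move=> lh gu i; apply: eq_localized (locM lh (gu i)) => x.
by rewrite mulr_sumr; apply: eq_bigr => k _; rewrite mulrA.
Qed.

Lemma good_shift u : good u -> good (fun k x => u k x * y k x).
Proof.
move=> gu i; apply: eq_localized (gu i.+1) => x.
by apply: eq_bigr => k _; rewrite exprS mulrA.
Qed.

Lemma eq_good u v : (forall k x, u k x = v k x) -> good u -> good v.
Proof. by move=> uv; rewrite (_ : v = u) //; apply: funext => k; apply: funext => x. Qed.

(* The derivative at [y k] of the cubic with roots [y 0, y 1, y 2]. *)
Let diff k x := (y k x - y (k + 1) x) * (y k x - y (k + 2) x).

Lemma good_diff u : good u -> good (fun k x => u k x * diff k x).
Proof.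
have [l1 l2 l3] := localized_esyms; move=> gu.
apply: (eq_good (u := fun k x => (3 * (u k x * y k x * y k x)
    + (-2 * s1 x) * (u k x * y k x)) + s2 x * u k x)).
  have [e01 e02 e11 e12 [e21 e22]] := ord3E.
  by elim/ord3P=> x; rewrite /diff ?(e01, e02, e11, e12, e21, e22) /s1 /s2; ring.
apply: goodD; last exact: goodM.
apply: goodD; apply: goodM; do ?apply: good_shift => //.
  exact: localized_cst.
by apply: locM => //; apply: localized_cst.
Qed.

(* The Bezoutian [s^2 + s t + t^2 - s1 (s + t) + s2] of the cubic vanishes at
   distinct roots and equals [diff] on the diagonal. *)
Lemma good_bezout u : good u -> good (fun k x => u k x * (w k * diff k x)).
Proof.
have [l1 l2 l3] := localized_esyms; move=> gu i.
have [e01 e02 e11 e12 [e21 e22]] := ord3E.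
pose q i x := \sum_k w k * y k x ^+ i.
pose p i x := \sum_k u k x * y k x ^+ i.
apply: (eq_localized (g := fun x => q 0 x * p i.+2 x + q 1 x * p i.+1 x + q 2 x * p i x
   - s1 x * (q 0 x * p i.+1 x + q 1 x * p i x) + s2 x * (q 0 x * p i x))).
  move=> x; rewrite /q /p /diff /s1 /s2 !(sum_ord3 _ 0) !e01 !e02 e11 e12 e21 e22 !exprS; ring.
have Lq j : loc (q j) by apply: good_weights.
have Lp j : loc (p j) by apply: gu.
by do ![exact: Lq | exact: Lp | exact: l1 | exact: l2 | apply: locB | apply: locD | apply: locM].
Qed.

Let node k x := w k * (w k - w (k + 1)) * (w k - w (k + 2)) * diff k x ^+ 2.

(** The factor [(w j - w (k + 1)) * (w j - w (k + 2))] vanishes at the two nodes other than [k], so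
    one term survives in each moment. It is quadratic in [w j], and each multiplication by [w j]
    through [good_bezout] costs a [diff j], whence the square. *)
Lemma localized_node k : loc (node k) /\ loc (fun x => y k x * node k x).
Proof.
have [e01 e02 e11 e12 [e21 e22]] := ord3E.
pose u j x := w j * (w j - w (k + 1)) * (w j - w (k + 2)) * diff j x ^+ 2.
have gw := good_weights.
have gu : good u.
  apply: (eq_good (u := fun j x => (w j * (w j * diff j x) * (w j * diff j x)
     + (- (w (k + 1) + w (k + 2))) * (w j * (w j * diff j x) * diff j x))
     + w (k + 1) * w (k + 2) * (w j * diff j x * diff j x))).
    by move=> j x; rewrite /u; ring.
  apply: goodD; first apply: goodD.
  - by do 2 apply: good_bezout.
  - by apply: goodM; [apply: localized_cst | apply/good_diff/good_bezout].
  - by apply: goodM; [apply: localized_cst | do 2 apply: good_diff].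
have uE i x : \sum_j u j x * y j x ^+ i = node k x * y k x ^+ i.
  by rewrite (sum_ord3 _ k) /u /node !subrr; ring.
split; first by apply: eq_localized (gu 0%N) => x; rewrite uE mulr1.
by apply: eq_localized (gu 1%N) => x; rewrite uE mulrC.
Qed.

Hypothesis w_inj : injective w.

(** With [d] a common denominator, [d * y k] is polynomial and its power sums of degree [i] are
    divisible by [d ^+ i], so [polyfun_dvd_power_sums] divides it by [d]. The point [x0] witnesses
    that [d] is not identically zero. *)
Lemma polyfun_lift x0 : (forall i j, y i x0 = y j x0 -> i = j) ->
  exists (d : 'M[F]_(a, b) -> F) (phi : 'I_3 -> 'M[F]_(a, b) -> F),
    [/\ polyfun d, forall k, polyfun (phi k), d x0 != 0
      & forall x, d x != 0 -> forall k, y k x = phi k x].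
Proof.
move=> y0_inj; pose N x := node 0 x * node 1 x * node 2 x.
have nz j k (ne : j != k) : (w j - w k != 0) && (y j x0 - y k x0 != 0).
  rewrite !subr_eq0; apply/andP.
  by split; apply: contra ne => /eqP; [move/w_inj | move/y0_inj] => ->.
have [[n0 L0] [n1 L1] [n2 L2] [n3 L3]] :
    [/\ loc N, loc (fun x => y 0 x * N x), loc (fun x => y 1 x * N x) & loc (fun x => y 2 x * N x)].
  have [l0 m0] := localized_node 0; have [l1 m1] := localized_node 1.
  have [l2 m2] := localized_node 2.
  split.
  - exact: locM (locM l0 l1) l2.
  - apply: eq_localized (locM (locM m0 l1) l2) => x; rewrite /N; ring.
  - apply: eq_localized (locM (locM l0 m1) l2) => x; rewrite /N; ring.
  - apply: eq_localized (locM (locM l0 l1) m2) => x; rewrite /N; ring.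
pose n := (n0 + n1 + n2 + n3)%N; pose d x := hankel3 x ^+ n * N x.
have up m h : (m <= n)%N -> polyfun (fun x => hankel3 x ^+ m * h x) ->
    polyfun (fun x => hankel3 x ^+ n * h x).
  move=> le_mn pm; apply: eq_polyfun (polyfunM (polyfunX (n - m) polyfun_hankel3) pm) => x.
  by rewrite mulrA -exprD subnK.
have pd : polyfun d by apply: up L0; rewrite /n -!addnA leq_addr.
have pr k : polyfun (fun x => d x * y k x).
  apply: (eq_polyfun (g := fun x => hankel3 x ^+ n * (y k x * N x))).
    by move=> x; rewrite /d; ring.
  elim/ord3P: k; [apply: up L1|apply: up L2|apply: up L3]; rewrite /n; lia.
have dx0 : d x0 != 0.
  rewrite /d /N hankel3E /node /diff.
  have [e01 e02 e11 e12 [e21 e22]] := ord3E.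
  rewrite !(e01, e02, e11, e12, e21, e22).
  have [/nz/andP[? ?] /nz/andP[? ?] /nz/andP[? ?]] :
    [/\ (0 : 'I_3) != 1, (0 : 'I_3) != 2 & (1 : 'I_3) != 2] by [].
  have [/nz/andP[? ?] /nz/andP[? ?] /nz/andP[? ?]] :
    [/\ (1 : 'I_3) != 0, (2 : 'I_3) != 0 & (2 : 'I_3) != 1] by [].
  have wk k : w k != 0 by rewrite Num.Theory.lt0r_neq0.
  by rewrite !(mulf_neq0, expf_neq0).
have /choice[phi phiP] : forall k, exists g, polyfun g /\ forall x, d x * y k x = d x * g x.
  apply: (polyfun_dvd_power_sums w0 pd pr (q := fun i x => \sum_k w k * y k x ^+ i) _ dx0) => i.
    by move=> /andP[_ i3]; apply/moments/(leq_trans i3).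
  by move=> _ x; rewrite mulr_suml; apply: eq_bigr => j _; rewrite exprMn mulrCA mulrC.
exists d, phi; split=> // [k|x dx k]; first by have [] := phiP k.
by apply: (mulfI dx); have [_ ->] := phiP k.
Qed.

End Recovery.

(** Equal moments up to degree 5 give equal weighted sums of every polynomial of degree at most 5
    over the two configurations. The Hankel determinant first shows that the [z k] are distinct;
    test polynomials do the rest. *)
Lemma power_sums_inj (F : numClosedFieldType) (w y z : 'I_3 -> F) :
  (forall k, 0 < w k) -> injective w -> injective y ->
  (forall i, (i <= 5)%N -> \sum_k w k * y k ^+ i = \sum_k w k * z k ^+ i) -> y =1 z.
Proof.
move=> w0 w_inj y_inj S k.
have nw i : w i != 0 by rewrite Num.Theory.lt0r_neq0.
have zne i j : i != j -> z i != z j.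
  have : hankel3 w (fun k (_ : 'M_(1, 1)) => z k) 0 != 0.
    rewrite /hankel3 -!S // -[X in X != 0]/(hankel3 w (fun k (_ : 'M_(1, 1)) => y k) 0).
    rewrite hankel3E !(mulf_neq0, expf_neq0) ?subr_eq0 ?nw //;
      by apply/negP => /eqP/y_inj.
  rewrite hankel3E mulf_eq0 expf_eq0 /= !mulf_eq0 !negb_or !subr_eq0.
  move=> /andP[_ /andP[/andP[z01 z02] z12]].
  by elim/ord3P: i; elim/ord3P: j => // _; rewrite // eq_sym.
have ES (p : {poly F}) : (size p <= 6)%N -> \sum_j w j * p.[y j] = \sum_j w j * p.[z j].
  have E v : (size p <= 6)%N ->
      \sum_j w j * p.[v j] = \sum_(i < 6) p`_i * (\sum_j w j * v j ^+ i).
    move=> sp; under [RHS]eq_bigr do rewrite mulr_sumr; rewrite exchange_big /=.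
    apply: eq_bigr => j _; rewrite (horner_coef_wide _ sp) mulr_sumr.
    by apply: eq_bigr => i _; rewrite mulrCA.
  by move=> sp; rewrite !E //; apply: eq_bigr => i _; rewrite S // -ltnS.
have zy j : (z j == y k) || (z j == y (k + 1)) || (z j == y (k + 2)).
  (* Degree exactly five: all three [y] and the two other [z] are roots, so only [w j * p.[z j]]
     remains and must vanish. *)
  pose p := ('X - (y k)%:P) * ('X - (y (k + 1))%:P) * ('X - (y (k + 2))%:P)
     * ('X - (z (j + 1))%:P) * ('X - (z (j + 2))%:P).
  have := ES p; rewrite !size_Mmonic ?(rpredM, monicXsubC, monic_neq0) // !size_XsubC => /(_ isT).
  rewrite (sum_ord3 _ k) (sum_ord3 (fun i => w i * p.[z i]) j) !hornerM !hornerXsubC.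
  rewrite !subrr !(mulr0, mul0r) !addr0 => /esym/eqP.
  rewrite !mulf_eq0 (negbTE (nw j)) !subr_eq0 /=.
  have /negbTE -> : z j != z (j + 1) by apply: zne; have [] := ord3_neq j.
  have /negbTE -> : z j != z (j + 2) by apply: zne; have [] := ord3_neq j.
  by rewrite !orbF.
(* This test polynomial compares [w k] with the weight of the index [j] for which [z j] is [y k];
   distinct weights force that index to be [k]. *)
pose L := ('X - (y (k + 1))%:P) * ('X - (y (k + 2))%:P).
have Lk : L.[y k] != 0.
  have [n1 n2 _] := ord3_neq k; rewrite !hornerM !hornerXsubC mulf_neq0 // subr_eq0;
    by apply/eqP => /y_inj/eqP; apply/negP.
have Lz j : L.[z j] = if z j == y k then L.[y k] else 0.
  have := zy j; case: eqP => [->//|_] /=.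
  by move=> /orP[]/eqP->; rewrite !hornerM !hornerXsubC subrr ?(mul0r, mulr0).
have := ES L; rewrite !size_Mmonic ?(monicXsubC, monic_neq0) // !size_XsubC => /(_ isT).
have Ly1 : L.[y (k + 1)] = 0 by rewrite !hornerM !hornerXsubC subrr mul0r.
have Ly2 : L.[y (k + 2)] = 0 by rewrite !hornerM !hornerXsubC subrr mulr0.
rewrite !(sum_ord3 _ k) Ly1 Ly2 !Lz !mulr0 !addr0.
have [n1 n2 n12] := ord3_neq k.
case: (eqVneq (z k) (y k)) => [->//|_].
have wL j : j != k -> w k * L.[y k] = w j * L.[y k] -> y k = z k.
  by move=> ne /(mulIf Lk)/w_inj E; rewrite E eqxx in ne.
case: eqP => [z1|_]; case: eqP => [z2|_].
- by have := zne _ _ n12; rewrite z1 z2 eqxx.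
- by rewrite !mulr0 add0r addr0; apply: wL; rewrite eq_sym.
- by rewrite !mulr0 !add0r; apply: wL; rewrite eq_sym.
- by rewrite !mulr0 !addr0 => /eqP; rewrite mulf_eq0 (negbTE (nw k)) (negbTE Lk).
Qed.

(** * Newton's identities *)

Lemma coef_poly3 (A : nzRingType) n i (f g h : nat -> A) :
  (\poly_(a < n) f a * \poly_(b < n) g b * \poly_(c < n) h c)`_i =
  \sum_(a < n) \sum_(b < n) \sum_(c < n | (a + b + c == i)%N) f a * g b * h c.
Proof.
have XM (c d : A) k l : (c *: 'X^k) * (d *: 'X^l) = (c * d) *: 'X^(k + l).
  rewrite -!mul_polyC -!mulrA (mulrA 'X^k) -(commr_polyXn d%:P k) polyCM exprD !mulrA.
  by [].
rewrite !poly_def !mulr_suml coef_sum; apply: eq_bigr => a _.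
rewrite [X in X * _]mulr_sumr mulr_suml coef_sum; apply: eq_bigr => b _.
rewrite mulr_sumr coef_sum [RHS]big_mkcond; apply: eq_bigr => c _ /=.
rewrite !XM coefZ coefXn.
by rewrite eq_sym; case: eqP; rewrite ?mulr1 ?mulr0.
Qed.

Section NewtonIdentities.
Variable R : realType.
Local Notation C := R[i].

Definition eq_upto (A : nzRingType) (N : nat) (p q : {poly A}) :=
  forall i, (i <= N)%N -> p`_i = q`_i.

Lemma eq_uptoM (A : nzRingType) N (p q p' q' : {poly A}) :
  eq_upto N p q -> eq_upto N p' q' -> eq_upto N (p * p') (q * q').
Proof.
move=> pq pq' i le_iN; rewrite !coefM; apply: eq_bigr => j _.
by rewrite pq ?pq' // ?(leq_trans (leq_subr _ _)) // (leq_trans _ le_iN) // -ltnS.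
Qed.

Lemma gbinomS (y : C) a : a.+1%:R * gbinom y a.+1 = (y - a%:R) * gbinom y a.
Proof.
rewrite /gbinom big_ord_recr /= factS natrM invfM; field.
by rewrite nat1r !Num.Theory.pnatr_eq0 -lt0n fact_gt0.
Qed.

Variable A : comAlgType C.
Implicit Types (y : C) (x : A).

Definition binomial_series N y x : {poly A} := \poly_(a < N.+1) (gbinom y a *: x ^+ a).

(** Truncation of [y x T / (1 + x T)], that is of [T (log B)'] for [B = (1 + x T) ^ y], not of
    [log B] itself. *)
Definition log_series N y x : {poly A} :=
  \poly_(j < N.+1) (if j is j'.+1 then ((-1) ^+ j' * y) *: x ^+ j else 0).

(* [T B' = B * (T (log B)')] for [B = (1 + x T) ^ y]. *)
Lemma binomial_series_ode N y x : eq_upto N ('X * (binomial_series N y x)^`())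
  (binomial_series N y x * log_series N y x).
Proof.
have cb i : (i <= N)%N -> (binomial_series N y x)`_i = gbinom y i *: x ^+ i.
  by move=> iN; rewrite coef_poly ltnS iN.
have cX i : ('X * (binomial_series N y x)^`())`_i = (binomial_series N y x)`_i *+ i.
  by rewrite coefXM coef_deriv; case: i.
have cl i : (i <= N)%N -> (log_series N y x)`_i =
    if i is j'.+1 then ((-1) ^+ j' * y) *: x ^+ i else 0.
  by move=> iN; rewrite coef_poly ltnS iN.
elim=> [|i IH] iN; rewrite cX coefM; first by rewrite big_ord1 cl // mulr0.
have := IH (ltnW iN); rewrite cX coefM !big_ord_recr /= !subnn cl // !mulr0 !addr0.
move=> IH'; rewrite subSnn [(log_series _ _ _)`_1]cl //; last exact: leq_trans iN.
(* In positive degrees [log_series] is geometric of ratio [- x], so these terms sum to [- x] times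
   the identity in degree [i]. *)
rewrite (eq_bigr (fun j : 'I_i =>
    - x * ((binomial_series N y x)`_j * (log_series N y x)`_(i - j)))).
  rewrite -mulr_sumr -IH' !cb ?(ltnW iN) //.
  have := gbinomS y i; move: (gbinom y i.+1) (gbinom y i) => g' g E.
  rewrite -scaler_nat scalerA E exprS expr0 mul1r expr1.
  have -> : - x * (g *: x ^+ i *+ i) = - (i%:R * g) *: (x * x ^+ i).
    by rewrite mulNr mulrnAr -scalerAr -scaler_nat scalerA scaleNr.
  rewrite -scalerAr -scalerAl scalerA.
  by rewrite [x ^+ i * x]mulrC -scalerDl; congr (_ *: _); ring.
move=> j _; rewrite !cl ?(leq_trans (leq_subr _ _)) // 1?ltnW //.
rewrite (_ : (i.+1 - j = (i - j.+1).+2)%N); last by have := ltn_ord j; lia.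
rewrite (_ : (i - j = (i - j.+1).+1)%N); last by have := ltn_ord j; lia.
rewrite [RHS]mulrCA; congr (_ * _).
by rewrite [x ^+ _.+2]exprS [(-1) ^+ _.+1]exprS mulN1r mulNr scaleNr mulNr scalerAr.
Qed.

Lemma esym_coef N i y1 y2 y3 x1 x2 x3 : (i <= N)%N -> Defs.esym i y1 y2 y3 x1 x2 x3 =
  (binomial_series N y1 x1 * binomial_series N y2 x2 * binomial_series N y3 x3)`_i.
Proof.
move=> iN.
have E M y x : (i <= M)%N -> eq_upto i (binomial_series M y x) (binomial_series i y x).
  by move=> iM j ji; rewrite !coef_poly !ltnS (leq_trans ji) ?ji.
rewrite (eq_uptoM (eq_uptoM (E _ _ _ iN) (E _ _ _ iN)) (E _ _ _ iN)) //.
rewrite coef_poly3; apply: eq_bigr => a _; apply: eq_bigr => b _; apply: eq_bigr => c _.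
have SM (p q : C) (u v : A) : (p *: u) * (q *: v) = (p * q) *: (u * v).
  by rewrite -scalerAl -scalerAr scalerA.
by rewrite !SM.
Qed.

(** The operator [T d/dT] on a product of three binomial series multiplies it by the sum of their
    [log_series]; the identity is the coefficient of degree [i]. *)
Lemma newton_esym i y1 y2 y3 x1 x2 x3 :
  i%:R * Defs.esym i y1 y2 y3 x1 x2 x3 = \sum_(j < i) (-1) ^+ j *
    (Defs.esym (i - j.+1) y1 y2 y3 x1 x2 x3 *
      (y1 *: x1 ^+ j.+1 + y2 *: x2 ^+ j.+1 + y3 *: x3 ^+ j.+1)).
Proof.
pose b1 := binomial_series i y1 x1; pose b2 := binomial_series i y2 x2.
pose b3 := binomial_series i y3 x3.
pose l := log_series i y1 x1 + log_series i y2 x2 + log_series i y3 x3.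
have ode : eq_upto i ('X * (b1 * b2 * b3)^`()) (b1 * b2 * b3 * l).
  have E1 := binomial_series_ode (N := i) y1 x1.
  have E2 := binomial_series_ode (N := i) y2 x2.
  have E3 := binomial_series_ode (N := i) y3 x3.
  rewrite -/b1 -/b2 -/b3 in E1 E2 E3.
  move=> j ji.
  have -> : 'X * (b1 * b2 * b3)^`() = ('X * b1^`()) * (b2 * b3) + ('X * b2^`()) * (b1 * b3)
       + ('X * b3^`()) * (b1 * b2) by rewrite !derivM; ring.
  have -> : b1 * b2 * b3 * l = (b1 * log_series i y1 x1) * (b2 * b3)
     + (b2 * log_series i y2 x2) * (b1 * b3) + (b3 * log_series i y3 x3) * (b1 * b2).
    by rewrite /l; ring.
  rewrite !coefD; congr (_ + _ + _); [exact: (eq_uptoM E1 (fun _ _ => erefl))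
    | exact: (eq_uptoM E2 (fun _ _ => erefl)) | exact: (eq_uptoM E3 (fun _ _ => erefl))].
have bE k : (k <= i)%N -> (b1 * b2 * b3)`_k = Defs.esym k y1 y2 y3 x1 x2 x3.
  by move=> ki; rewrite (esym_coef _ _ _ _ _ _ ki).
have lE k : (k < i)%N -> l`_k.+1 =
    (-1) ^+ k * (y1 *: x1 ^+ k.+1 + y2 *: x2 ^+ k.+1 + y3 *: x3 ^+ k.+1).
  move=> ki; rewrite /l !coefD !coef_poly !ltnS ki !mulrDr -!scalerA.
  have S (u : A) : (-1) ^+ k *: u = (-1) ^+ k * u.
    by rewrite -[in LHS]signr_odd -[in RHS]signr_odd scaler_sign mulr_sign.
  by rewrite !S.
have l0 : l`_0 = 0 by rewrite /l !coefD !coef_poly /= !addr0.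
have := ode i (leqnn i); rewrite coefXM coef_deriv.
move: bE lE l0 {ode}; move: (b1 * b2 * b3) (l) => b l' bE lE l0; clear b1 b2 b3 l.
rewrite coefMr big_ord_recl /= l0 mulr0 add0r.
case: i bE lE => [|i] bE lE; first by move=> _; rewrite mulr0n mul0r big_ord0.
rewrite /= bE // mulr_natl => ->; apply: eq_bigr => j _.
by rewrite lE // bE ?leq_subr // mulrCA.
Qed.

End NewtonIdentities.

(** * The coordinates of the fiber as functions of the matrix *)

Section Coefficientwise.
Variables (A : comNzRingType) (n : nat) (T : Type) (P : (T -> A) -> Prop).
Hypothesis P_cst : forall c, P (fun=> c).
Hypothesis PD : forall f g, P f -> P g -> P (fun t => f t + g t).
Hypothesis PM : forall f g, P f -> P g -> P (fun t => f t * g t).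

(** [P] is instantiated both with [polyfun] and with [flat], which share these closure
    properties. *)
Definition coefwise (H : T -> {mpoly A[n]}) := forall mu, P (fun t => (H t)@_mu).

Lemma P_sum (I : Type) (r : seq I) (Q : pred I) (f : I -> T -> A) :
  (forall i, Q i -> P (f i)) -> P (fun t => \sum_(i <- r | Q i) f i t).
Proof.
move=> Pf; elim: r => [|i r IH].
  by rewrite (_ : (fun t => _) = (fun=> 0)) //; apply: funext => t; rewrite big_nil.
case Qi: (Q i); last first.
  rewrite (_ : (fun t => _) = (fun t => \sum_(i <- r | Q i) f i t)) //.
  by apply: funext => t; rewrite big_cons Qi.
rewrite (_ : (fun t => _) = (fun t => f i t + \sum_(i <- r | Q i) f i t)); last first.
  by apply: funext => t; rewrite big_cons Qi.
by apply: PD => //; apply: Pf.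
Qed.

Lemma coefwise_cst p : coefwise (fun=> p).
Proof. by move=> mu; apply: P_cst. Qed.

Lemma coefwise_sum (I : Type) (r : seq I) (Q : pred I) (H : I -> T -> {mpoly A[n]}) :
  (forall i, Q i -> coefwise (H i)) -> coefwise (fun t => \sum_(i <- r | Q i) H i t).
Proof.
move=> PH mu; rewrite (_ : (fun t => _) = (fun t => \sum_(i <- r | Q i) (H i t)@_mu)).
  by apply: P_sum => i Qi; apply: PH.
by apply: funext => t; rewrite raddf_sum.
Qed.

Lemma coefwiseM (H K : T -> {mpoly A[n]}) :
  coefwise H -> coefwise K -> coefwise (fun t => H t * K t).
Proof.
move=> PH PK mu.
rewrite (_ : (fun t => _) = (fun t => \sum_(k : 'X_{1..n < (mdeg mu).+1, (mdeg mu).+1}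
    | mu == (k.1 + k.2)%MM) (H t)@_k.1 * (K t)@_k.2)).
  by apply: P_sum => k _; apply: PM.
by apply: funext => t; rewrite mcoeffM.
Qed.

Lemma coefwiseX k (H : T -> {mpoly A[n]}) : coefwise H -> coefwise (fun t => H t ^+ k).
Proof.
move=> PH; elim: k => [|k IH]; first by under eq_fun do rewrite expr0; apply: coefwise_cst.
by under eq_fun do rewrite exprS; apply: coefwiseM.
Qed.

Lemma coefwiseZ c (H : T -> {mpoly A[n]}) : coefwise H -> coefwise (fun t => c *: H t).
Proof.
by move=> PH; under eq_fun do rewrite -mul_mpolyC; apply: coefwiseM => //; apply: coefwise_cst.
Qed.

End Coefficientwise.

Section EsymVectors.
Variables (R : realType) (n : nat).
Local Notation C := R[i].
Implicit Types (m : 'rV[C]_3) (x : 'M[C]_(3, n)) (u : 'I_n -> C).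

Definition rows x (k : 'I_3) : 'rV[C]_n := row k x.

Definition psum_vec i m x : {mpoly C[n]} := \sum_k m 0 k *: linform (rows x k) ^+ i.

Lemma newton_esym_vec i m x : i%:R * esym_vec i m (rows x) =
  \sum_(j < i) (-1) ^+ j * (esym_vec (i - j.+1) m (rows x) * psum_vec j.+1 m x).
Proof.
have [e01 e02 _ _ _] := ord3E.
rewrite /esym_vec newton_esym; apply: eq_bigr => j _.
by rewrite /psum_vec (sum_ord3 _ 0) e01 e02.
Qed.

Lemma esym_vec0 m x : esym_vec 0 m (rows x) = 1.
Proof.
rewrite /esym_vec /Defs.esym !big_ord1 big_mkcond big_ord1 /= /gbinom !big_ord0.
by rewrite !mul1r fact0 invr1 !expr0 !mulr1 scale1r.
Qed.

Lemma linform_eval (v : 'rV[C]_n) u : (linform v).@[u] = \sum_l v 0 l * u l.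
Proof. by rewrite /linform raddf_sum /=; apply: eq_bigr => l _; rewrite mevalZ mevalXU. Qed.

Lemma linform_linear c (v1 v2 : 'rV[C]_n) : linform (c *: v1 + v2) = c *: linform v1 + linform v2.
Proof.
rewrite /linform scaler_sumr -big_split; apply: eq_bigr => l _.
by rewrite !mxE scalerDl scalerA.
Qed.

Lemma linform0 : linform (0 : 'rV[C]_n) = 0.
Proof. by rewrite /linform big1 // => l _; rewrite mxE scale0r. Qed.

Lemma esym_vec_eval N i u : (i <= N)%N -> exists h : 'rV_#|symprod_basis n N| -> C,
  polyfun h /\ forall m x, (esym_vec i m (rows x)).@[u] = h (esym_point N m (rows x)).
Proof.
case: i => [|i] iN.
  by exists (fun=> 1); split=> [|m x]; [apply: polyfun_cst | rewrite esym_vec0 meval1].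
exists (fun y => \sum_(j | mdeg (symprod_mnm j) == i.+1) y 0 j * \prod_k u k ^+ symprod_mnm j k).
split=> [|m x].
  apply: polyfun_sum => j _; apply: polyfunM; [exact: polyfun_coord | exact: polyfun_cst].
have /dhomogP hmg := esym_vec_homog i.+1 m (rows x).
set p := esym_vec _ _ _ in hmg *.
have szp : (msize p <= N.+1)%N.
  rewrite msizeE; apply/bigmax_leqP_seq => mu mup _; rewrite ltnS.
  by rewrite (hmg _ mup).
rewrite [in LHS](mpolywE szp) raddf_sum /=.
rewrite (bigID (fun mu : 'X_{1..n < N.+1} => mdeg mu == i.+1)) /=.
rewrite [X in _ + X]big1 => [|mu ne]; last first.
  rewrite mevalZ; case: (boolP (bmnm mu \in msupp p)) => [/hmg E|].
    by rewrite E eqxx in ne.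
  by rewrite -mcoeff_eq0 => /eqP ->; rewrite mul0r.
rewrite addr0 (reindex_omap (fun j : 'I_#|symprod_basis n N| => val (enum_val j))
  (fun mu => omap enum_rank (insub mu))) /=.
  rewrite (eq_bigl (fun j : 'I_#|symprod_basis n N| => mdeg (symprod_mnm j) == i.+1)) =>
    [|j]; last first.
    by rewrite valK /= enum_valK eqxx andbT.
  by apply: eq_bigr => j /eqP E; rewrite mevalZ mevalX mxE E.
move=> mu /eqP E; have mu0 : mdeg mu != 0%N by rewrite E.
by rewrite (insubT (fun mu : 'X_{1..n < N.+1} => mdeg mu != 0%N) mu0) /= enum_rankK.
Qed.

(** Newton's identities are triangular: the last term is the top power sum up to sign, and all other
    power sums in it have lower degree. *)
Lemma psum_vec_eval N i m u : (0 < i <= N)%N -> exists h : 'rV_#|symprod_basis n N| -> C,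
  polyfun h /\ forall x, (psum_vec i m x).@[u] = h (esym_point N m (rows x)).
Proof.
have [k] := ubnP i; elim: k i => // k IH [//|i] /ltnSE ik /= iN.
have /choice[e eP] : forall j, exists h : 'rV_#|symprod_basis n N| -> C, (j <= N)%N ->
    polyfun h /\ forall x, (esym_vec j m (rows x)).@[u] = h (esym_point N m (rows x)).
  move=> j; case: (leqP j N) => jN; last by exists (fun=> 0).
  by have [h [ph hP]] := esym_vec_eval u jN; exists h.
have /choice[p pP] : forall j, exists h : 'rV_#|symprod_basis n N| -> C, (j < i)%N ->
    polyfun h /\ forall x, (psum_vec j.+1 m x).@[u] = h (esym_point N m (rows x)).
  move=> j; case: (ltnP j i) => ji; last by exists (fun=> 0).
  have [||h [ph hP]] := IH j.+1; first exact: leq_trans ik.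
    by rewrite /= (leq_trans ji) // ltnW.
  by exists h.
exists (fun y => (-1) ^+ i * (i.+1%:R * e i.+1 y -
  \sum_(j < i) (-1) ^+ j * (e (i.+1 - j.+1)%N y * p j y))); split=> [|x].
  apply: polyfunM; first exact: polyfun_cst.
  apply: polyfunB; first by apply: polyfunM; [apply: polyfun_cst | apply: (eP i.+1 iN).1].
  apply: polyfun_sum => j _; apply: polyfunM; first exact: polyfun_cst.
  apply: polyfunM; last exact: (pP j (ltn_ord j)).1.
  by apply: (eP _ _).1; rewrite subSS (leq_trans (leq_subr _ _)) // ltnW.
have := congr1 (meval u) (newton_esym_vec i.+1 m x).
rewrite big_ord_recr /= subnn esym_vec0 mul1r mevalD !mevalM (eP _ iN).2 raddf_sum /=.
rewrite (_ : i.+1%:R.@[u] = i.+1%:R); last by rewrite -mpolyC_nat mevalC.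
have sgnE l : ((-1) ^+ l : {mpoly C[n]}).@[u] = (-1) ^+ l.
  by rewrite rmorphXn /= rmorphN1.
rewrite sgnE => E.
rewrite {}E (eq_bigr (fun j : 'I_i => (-1) ^+ j *
    (e (i.+1 - j.+1)%N (esym_point N m (rows x)) * p j (esym_point N m (rows x))))).
  by rewrite addrAC subrr add0r mulrA -exprD addnn -signr_odd odd_double mul1r.
move=> j _; rewrite !mevalM sgnE (pP j (ltn_ord j)).2 (eP _ _).2 //.
by rewrite subSS (leq_trans (leq_subr _ _)) // ltnW.
Qed.

Lemma polyfun_esym_point N m j : polyfun (fun x => esym_point N m (rows x) 0 j).
Proof.
apply: (eq_polyfun (g := fun x => (esym_vec (mdeg (symprod_mnm j)) m (rows x))@_(symprod_mnm j))).
  by move=> x; rewrite mxE.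
move: (symprod_mnm j); have cL k : coefwise (@polyfun _ _ _) (fun x => linform (rows x k)).
  move=> mu; rewrite /linform.
  apply: (eq_polyfun (g := fun x => \sum_l x k l * ('X_l : {mpoly C[n]})@_mu)).
    by move=> x; rewrite raddf_sum; apply: eq_bigr => l _ /=; rewrite mcoeffZ mxE.
  by apply: polyfun_sum => l _; apply: polyfunM; [apply: polyfun_coord | apply: polyfun_cst].
have cst := @polyfun_cst C 3 n.
have add := @polyfunD C 3 n.
have mul := @polyfunM C 3 n.
move=> mu; apply: (coefwise_sum cst add) => a _.
apply: (coefwise_sum cst add) => b _; apply: (coefwise_sum cst add) => c _.
apply: (coefwiseZ cst add mul); apply: (coefwiseM cst add mul).
  by apply: (coefwiseM cst add mul); apply: (coefwiseX cst add mul).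
exact: (coefwiseX cst add mul).
Qed.

Lemma psum_vec_line i m x v mu : exists p : {poly C},
  (forall t, (psum_vec i.+1 m (x + t *: v))@_mu = p.[t]) /\
  p`_1 = (\sum_k m 0 k *: (linform (rows x k) ^+ i * linform (rows v k)))@_mu *+ i.+1.
Proof.
pose c k a := (linform (rows x k) ^+ (i.+1 - a) * linform (rows v k) ^+ a)@_mu *+ 'C(i.+1, a).
exists (\sum_k m 0 k *: \poly_(a < i.+2) c k a); split=> [t|].
  rewrite horner_sum raddf_sum; apply: eq_bigr => k _ /=.
  rewrite mcoeffZ hornerZ horner_poly; congr (_ * _).
  rewrite (_ : rows (x + t *: v) k = t *: rows v k + rows x k); last first.
    by apply/rowP => l; rewrite !mxE addrC.
  rewrite linform_linear addrC exprDn raddf_sum; apply: eq_bigr => a _ /=.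
  by rewrite exprZn -scalerAr mcoeffMn mcoeffZ /c mulrnAl mulrC.
rewrite coef_sum raddf_sum -sumrMnl; apply: eq_bigr => k _ /=.
rewrite coefZ coef_poly /= mcoeffZ /c subSS subn0 expr1 bin1.
by rewrite mulrnAr.
Qed.

(* On the locus where two of the vectors collide, moving them apart with fixed
   weighted sum changes no power sum to first order. *)
Lemma flat_esym_point N m x v c j : row (c + 1) x = row (c + 2) x -> row c v = 0 ->
  \sum_k m 0 k *: row k v = 0 -> flat (fun t => esym_point N m (rows (x + t *: v)) 0 j).
Proof.
move=> xc vc sv.
have cst := @flat_cst C; have add := @flatD C; have mul := @flatM C.
have fp i : coefwise (@flat C) (fun t => psum_vec i.+1 m (x + t *: v)).
  move=> mu; have [p [pE p1]] := psum_vec_line i m x v mu; exists p; split=> //.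
  rewrite p1 (sum_ord3 _ c) /rows vc linform0.
  rewrite mulr0 scaler0 add0r xc !scalerAr -mulrDr.
  move: sv; rewrite (sum_ord3 _ c) vc scaler0 add0r => sv.
  have := linform_linear (m 0 (c + 1)) (row (c + 1) v) (m 0 (c + 2) *: row (c + 2) v).
  rewrite sv -[_ *: row (c + 2) v]addr0 linform_linear linform0 addr0 => <-.
  by rewrite mulr0 mcoeff0 mul0rn.
rewrite (_ : (fun t => _) = (fun t => (esym_vec (mdeg (symprod_mnm j)) m
    (rows (x + t *: v)))@_(symprod_mnm j))); last by apply: funext => t; rewrite mxE.
move: (symprod_mnm j) (mdeg _) => mu i; move: mu.
rewrite -/(coefwise (@flat C) (fun t => esym_vec i m (rows (x + t *: v)))).
have [k] := ubnP i; elim: k i => // k IH [|i] /ltnSE ik.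
  by under eq_fun do rewrite esym_vec0; apply: coefwise_cst.
have nz : i.+1%:R != 0 :> C by rewrite Num.Theory.pnatr_eq0.
rewrite (_ : (fun t => _) = (fun t => i.+1%:R^-1 *: \sum_(j < i.+1) (-1) ^+ j *
    (esym_vec (i.+1 - j.+1) m (rows (x + t *: v)) * psum_vec j.+1 m (x + t *: v)))); last first.
  apply: funext => t; rewrite -newton_esym_vec mulr_natl.
  rewrite -[esym_vec _ _ _ *+ _]scaler_nat scalerA mulVf //.
  by rewrite scale1r.
apply: (coefwiseZ cst add mul); apply: (coefwise_sum cst add) => l _.
apply: (coefwiseM cst add mul); first exact: coefwise_cst.
apply: (coefwiseM cst add mul); last exact: fp.
by apply: IH; rewrite subSS; apply: leq_trans ik; rewrite ltnS leq_subr.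
Qed.


End EsymVectors.

(** * Lifting a morphism of fibers *)

Section Lifting.
Variables (R : realType) (n N : nat).
Hypothesis N5 : (5 <= N)%N.
Local Notation C := R[i].
Local Notation M := 'M[C]_(3, n).
Implicit Types (x v : M) (m : 'I_3 -> nat).

Definition wt m k : C := (m k)%:R.

Definition dot x k (u : 'rV[C]_n) : C := \sum_l x k l * u 0 l.

Definition epoint m x : 'rV[C]_#|symprod_basis n N| := esym_point N (natpoint R m) (rows x).

Lemma dot_delta x k l : dot x k (delta_mx 0 l) = x k l.
Proof.
rewrite /dot (bigD1 l) //= mxE !eqxx mulr1 big1 ?addr0 // => j /negbTE jl.
by rewrite mxE eqxx jl mulr0.
Qed.

Lemma power_sum_epoint m i u : (0 < i <= N)%N -> exists h, polyfun h /\
  forall x, \sum_k wt m k * dot x k u ^+ i = h (epoint m x).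
Proof.
move=> iN; have [h [ph hP]] := psum_vec_eval (natpoint R m) (fun l => u 0 l) iN.
exists h; split=> // x; rewrite -hP raddf_sum; apply: eq_bigr => k _ /=.
rewrite mevalZ rmorphXn /= linform_eval mxE; congr (_ * _ ^+ _).
by apply: eq_bigr => l _; rewrite mxE.
Qed.

Variable m : 'I_3 -> nat.
Hypotheses (m_gt0 : forall k, (0 < m k)%N) (m_inj : injective m).

Lemma wt_gt0 k : 0 < wt m k. Proof. by rewrite Num.Theory.ltr0n. Qed.

Lemma wt_inj : injective (wt m).
Proof. by move=> i j /eqP; rewrite Num.Theory.eqr_nat => /eqP /m_inj. Qed.

Lemma epoint_inj x z : (forall l, injective (fun k => x k l)) -> epoint m x = epoint m z -> x = z.
Proof.
move=> x_inj xz; apply/matrixP => k l; move: k.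
apply: (power_sums_inj wt_gt0 wt_inj (x_inj l)) => -[|i] iN.
  by apply: eq_bigr => k _; rewrite !expr0.
have [|h [_ hP]] := power_sum_epoint m (i := i.+1) (delta_mx 0 l); first exact: leq_trans N5.
have := hP x; rewrite xz -hP => E.
under eq_bigr do rewrite -(dot_delta x); rewrite E.
by apply: eq_bigr => k _; rewrite dot_delta.
Qed.

(** An arbitrary preimage [v x] of [E x] is polynomial, column by column, where the denominators of
    [polyfun_lift] do not vanish. Surjectivity yields a point over [t], whose columns have distinct
    entries, so these denominators are nonzero somewhere and density extends the identity. *)
Lemma epoint_lift (E : M -> 'rV[C]_#|symprod_basis n N|) :
  (forall j, polyfun (fun x => E x 0 j)) -> (forall x, exists x', E x = epoint m x') ->
  (forall x', exists x, E x = epoint m x') ->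
  exists phi : M -> M, (forall k l, polyfun (fun x => phi x k l)) /\
    forall x, epoint m (phi x) = E x.
Proof.
move=> pE /choice[v vP] Esurj.
pose t : M := \matrix_(k, l) (k : nat)%:R.
have t_inj l : injective (fun k => t k l).
  by move=> i j /eqP; rewrite !mxE Num.Theory.eqr_nat => /eqP /val_inj.
have [x0 x0P] := Esurj t.
have vx0 : v x0 = t.
  by apply/esym/epoint_inj; [exact: t_inj | rewrite -vP x0P].
have /choice[d dP] : forall l, exists d : M -> C, exists phi : 'I_3 -> M -> C,
    [/\ polyfun d, forall k, polyfun (phi k), d x0 != 0
      & forall x, d x != 0 -> forall k, v x k l = phi k x].
  move=> l; apply: (polyfun_lift wt_gt0 _ wt_inj) => [[|i] i5|i j].
  - apply: eq_polyfun (polyfun_cst _ _ (\sum_k wt m k)) => x.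
    by apply: eq_bigr => k _; rewrite mulr1.
  - have [|h [ph hP]] := power_sum_epoint m (i := i.+1) (delta_mx 0 l); first exact: leq_trans N5.
    apply: (eq_polyfun (g := fun x => h (E x))).
      by move=> x; rewrite vP -hP; apply: eq_bigr => k _; rewrite dot_delta.
    by apply: polyfun_comp => // a j; rewrite (ord1 a).
  - by rewrite vx0 => /t_inj.
have {dP} /choice[phi phiP] := dP.
exists (fun x => \matrix_(k, l) phi l k x); split=> [k l|x].
  by apply: (eq_polyfun (g := phi l k)) => [x|]; [rewrite mxE | have [] := phiP l].
apply/rowP => j; move: x.
apply: (polyfun_ext_dense (d := fun x => \prod_l d l x) (x0 := x0)).
- by apply: polyfun_prod => l; have [] := phiP l.
- apply: (polyfun_comp (polyfun_esym_point (natpoint R m) j)) => k l.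
  by apply: (eq_polyfun (g := phi l k)) => [x|]; [rewrite mxE | have [] := phiP l].
- exact: pE.
- by apply/prodf_neq0 => l _; have [] := phiP l.
move=> x /prodf_neq0 dx; rewrite vP; congr (epoint m _ 0 j).
by apply/matrixP => k l; rewrite mxE; have [_ _ _ <-] := phiP l; rewrite ?dx.
Qed.

(** Distinct weights leave no freedom to permute the rows: where each column has distinct entries,
    [epoint_inj] applies, and such matrices are dense. This makes two lifts of inverse morphisms
    inverse to each other. *)
Lemma epoint_section (E : M -> M) : (forall k l, polyfun (fun x => E x k l)) ->
  (forall x, epoint m (E x) = epoint m x) -> E =1 id.
Proof.
move=> pE EP x; apply/matrixP => k l; move: x.
pose d x := \prod_l \prod_k (x k l - x (k + 1) l).
apply: (polyfun_ext_dense (d := d) (x0 := \matrix_(k, l) (k : nat)%:R)) => //.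
- do 2 apply: polyfun_prod => ?; apply: polyfunB; exact: polyfun_coord.
- exact: polyfun_coord.
- apply/prodf_neq0 => j _; apply/prodf_neq0 => i _.
  by rewrite !mxE subr_eq0 Num.Theory.eqr_nat; have [] := ord3_neq i.
move=> x /prodf_neq0 dx; congr (fun_of_matrix _ k l); apply/esym/epoint_inj; last by rewrite EP.
move=> j i i'.
have {}dx a : x a j != x (a + 1) j.
  by have /prodf_neq0/(_ a isT) := dx j isT; rewrite subr_eq0.
have [e01 e02 e11 e12 [e21 e22]] := ord3E.
have := dx 0; have := dx 1; have := dx 2; rewrite e01 e11 e21 => x2 x1 x0.
have E3 : x 0 j != x 2 j by rewrite eq_sym.
by elim/ord3P: i; elim/ord3P: i' => // /eqP; rewrite ?(negbTE x0) ?(negbTE x1) ?(negbTE x2)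
  ?(negbTE E3) // eq_sym ?(negbTE x0) ?(negbTE x1) ?(negbTE x2).
Qed.

End Lifting.

(** * Diagonals and the differential of the lift *)

Section Diagonals.
Variables (R : realType) (n : nat).
Hypothesis n_gt0 : (0 < n)%N.
Local Notation C := R[i].
Local Notation M := 'M[C]_(3, n).
Implicit Types (x v : M) (m : 'I_3 -> nat).

(** Indexed by the row that stays free, so that [unit_row c] lies on the diagonal [c] and on no
    other. *)
Definition diagonal (c : 'I_3) x := row (c + 1) x = row (c + 2) x.

Definition collapsing m (c : 'I_3) v := row c v = 0 /\ \sum_k wt R m k *: row k v = 0.

Definition unit_row (c : 'I_3) : M := \matrix_(k, l) (k == c)%:R.

(** A linear retraction onto the diagonal [c]; precomposing with it turns density arguments on the
    diagonal into density arguments on all matrices. *)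
Definition to_diagonal (c : 'I_3) x : M := \matrix_(k, l) x (if k == c then c else c + 1) l.

Lemma to_diagonalP c x : diagonal c (to_diagonal c x).
Proof.
have [n1 n2 _] := ord3_neq c; apply/rowP => l.
by rewrite !mxE [_ == c]eq_sym (negbTE n1) [_ == c]eq_sym (negbTE n2).
Qed.

Lemma to_diagonal_id c x : diagonal c x -> to_diagonal c x = x.
Proof.
move=> /rowP xc; apply/matrixP => k l; have := xc l; rewrite !mxE.
have [e01 e02 e11 e12 [e21 e22]] := ord3E.
by elim/ord3P: c {xc}; elim/ord3P: k; rewrite ?(e01, e02, e11, e12, e21, e22) //= => ->.
Qed.

Lemma diagonal_entry c x i j l : diagonal c x -> c != i -> c != j -> x i l = x j l.
Proof.
move=> /rowP /(_ l); rewrite !mxE; have [e01 e02 e11 e12 [e21 e22]] := ord3E.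
by elim/ord3P: c; elim/ord3P: i; elim/ord3P: j; rewrite ?(e01, e02, e11, e12, e21, e22).
Qed.

Lemma polyfun_to_diagonal c (h : M -> C) : polyfun h -> polyfun (fun x => h (to_diagonal c x)).
Proof.
move=> ph; apply: (polyfun_comp ph) => k l.
by apply: eq_polyfun (polyfun_coord _ (if k == c then c else c + 1) l) => x; rewrite mxE.
Qed.

Lemma diagonal_unit_row c d : diagonal d (unit_row c) <-> d = c.
Proof.
split=> [/rowP /(_ (Ordinal n_gt0))|->]; last first.
  have [n1 n2 _] := ord3_neq c; apply/rowP => l.
  by rewrite !mxE [_ == c]eq_sym (negbTE n1) [_ == c]eq_sym (negbTE n2).
rewrite !mxE; move/eqP; rewrite Num.Theory.eqr_nat.
by elim/ord3P: c; elim/ord3P: d.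
Qed.

Lemma diagonalP x : ~ (exists c, diagonal c x) -> forall i j, i != j -> row i x != row j x.
Proof.
move=> nd i j ij; apply/eqP => xij; apply: nd.
have [e01 e02 e11 e12 [e21 e22]] := ord3E; rewrite /diagonal.
by elim/ord3P: i ij xij; elim/ord3P: j => // _ xij;
  [exists 2 | exists 1 | exists 2 | exists 0 | exists 1 | exists 0];
  rewrite ?(e01, e02, e11, e12, e21, e22).
Qed.

Lemma row_dot_neq x i j : row i x != row j x -> exists u, dot x i u - dot x j u != 0.
Proof.
apply: contra_neqP => nu; apply/rowP => l; rewrite !mxE -!(dot_delta x).
apply/eqP; rewrite -subr_eq0; apply/negPn/negP => ne.
by apply: nu; exists (delta_mx 0 l).
Qed.

Lemma polyfun_dot x k : polyfun (fun u => dot x k u).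
Proof.
apply: polyfun_sum => l _; apply: polyfunM; [exact: polyfun_cst | exact: polyfun_coord].
Qed.

Lemma row_dot_eq0 v k : (forall u, dot v k u = 0) -> row k v = 0.
Proof. by move=> v0; apply/rowP => l; rewrite !mxE -(dot_delta v). Qed.

(* [b] is a tangent vector at [a] killed by the differentials of the first three
   weighted power sums. *)
Section PowerSumKernel.
Variables (w : 'I_3 -> C) (a b : M).
Hypothesis w0 : forall k, w k != 0.
Hypothesis ker : forall i u, (i < 3)%N -> \sum_k w k * (dot a k u ^+ i * dot b k u) = 0.

Lemma kernel_weighted_sum : \sum_k w k *: row k b = 0.
Proof.
apply/rowP => l; have := ker (delta_mx 0 l) (ltn0Sn 2); rewrite summxE mxE => E.
by rewrite -[RHS]E; apply: eq_bigr => k _; rewrite !mxE expr0 mul1r dot_delta.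
Qed.

(** For a direction [z] separating row [k] of [a] from the two others, combining the relations with
    the coefficients of the quadratic polynomial vanishing at those two isolates row [k] of [b]. In
    [kernel_diagonal] the two others coincide and a linear polynomial is enough. *)
Lemma kernel_distinct : (forall i j, i != j -> row i a != row j a) -> b = 0.
Proof.
move=> a_inj; apply/row_matrixP => k; rewrite row0; have [n1 n2 _] := ord3_neq k.
have [u1 hu1] := row_dot_neq (a_inj _ _ n1); have [u2 hu2] := row_dot_neq (a_inj _ _ n2).
have p1 := polyfunB (polyfun_dot a k) (polyfun_dot a (k + 1)).
have p2 := polyfunB (polyfun_dot a k) (polyfun_dot a (k + 2)).
have [u3 [hu31 hu32]] := polyfun_domain p1 p2 hu1 hu2.
apply: row_dot_eq0 => u; apply/eqP/negPn/negP => bu.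
have [z [/= z12 zb]] := polyfun_domain (polyfunM p1 p2) (polyfun_dot b k) (mulf_neq0 hu31 hu32) bu.
have : w k * ((dot a k z - dot a (k + 1) z) * (dot a k z - dot a (k + 2) z) * dot b k z) = 0.
  transitivity (\sum_j w j * (dot a j z ^+ 2 * dot b j z)
    - (dot a (k + 1) z + dot a (k + 2) z) * (\sum_j w j * (dot a j z ^+ 1 * dot b j z))
    + dot a (k + 1) z * dot a (k + 2) z * (\sum_j w j * (dot a j z ^+ 0 * dot b j z))).
    by rewrite !(sum_ord3 _ k); ring.
  by rewrite !ker // !mulr0 subr0 addr0.
by move/eqP; rewrite mulf_eq0 (negbTE (w0 k)) mulf_eq0 (negbTE z12) (negbTE zb).
Qed.

Lemma kernel_diagonal c : diagonal c a -> row c a != row (c + 1) a -> row c b = 0.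
Proof.
move=> ac /row_dot_neq[u hu].
apply: row_dot_eq0 => u'; apply/eqP/negPn/negP => bu.
have [z [/= za zb]] := polyfun_domain (polyfunB (polyfun_dot a c) (polyfun_dot a (c + 1)))
   (polyfun_dot b c) hu bu.
have a12 : dot a (c + 2) z = dot a (c + 1) z.
  by apply: eq_bigr => l _; have /rowP/(_ l) := ac; rewrite !mxE => ->.
have : w c * ((dot a c z - dot a (c + 1) z) * dot b c z) = 0.
  transitivity (\sum_j w j * (dot a j z ^+ 1 * dot b j z)
    - dot a (c + 1) z * (\sum_j w j * (dot a j z ^+ 0 * dot b j z))).
    by rewrite !(sum_ord3 _ c) a12; ring.
  by rewrite !ker // mulr0 subr0.
by move/eqP; rewrite mulf_eq0 (negbTE (w0 c)) mulf_eq0 (negbTE za) (negbTE zb).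
Qed.

End PowerSumKernel.

End Diagonals.

Lemma addmxE (V : nmodType) (a b : nat) (A B : 'M[V]_(a, b)) i j : (A + B) i j = A i j + B i j.
Proof. exact: mxE. Qed.

Lemma scalemxE (A : pzRingType) (a b : nat) c (X : 'M[A]_(a, b)) i j : (c *: X) i j = c * X i j.
Proof. exact: mxE. Qed.

Section Transport.
Variables (R : realType) (n N : nat).
Hypotheses (n_gt0 : (0 < n)%N) (N5 : (5 <= N)%N).
Local Notation C := R[i].
Local Notation M := 'M[C]_(3, n).
Local Notation E := 'rV[C]_#|symprod_basis n N|.
Variables (m m' : 'I_3 -> nat) (f : E -> E) (phi eta : M -> M).
Hypotheses (m_gt0 : forall k, (0 < m k)%N) (m'_gt0 : forall k, (0 < m' k)%N).
Hypothesis pf : forall j, polyfun (fun y => f y 0 j).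
Hypotheses (pphi : forall k l, polyfun (fun x => phi x k l))
  (peta : forall k l, polyfun (fun x => eta x k l)).
Hypothesis phiE : forall x, epoint N m' (phi x) = f (epoint N m x).
Hypothesis etaK : forall x, eta (phi x) = x.
Implicit Types (x v : M).

Definition dphi x v : M := \matrix_(k, l) (line (fun z => phi z k l) x v)`_1.

Lemma dphiE x v k l : dphi x v k l = (line (fun z => phi z k l) x v)`_1.
Proof. exact: mxE. Qed.

Lemma dphi_linear x a u v : dphi x (a *: u + v) = a *: dphi x u + dphi x v.
Proof. apply/matrixP => k l.
rewrite addmxE scalemxE; apply: etrans (dphiE x _ k l) (etrans (dline_linear x a u v (pphi k l)) _).
by congr (_ * _ + _); apply/esym/dphiE.
Qed.

Lemma dphi_inj0 x v : dphi x v = 0 -> v = 0.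
Proof.
move=> /matrixP d0; apply/matrixP => k l.
have fphi i j : flat (fun t => phi (x + t *: v) i j).
  exists (line (fun z => phi z i j) x v); split=> [t|]; first exact: lineP (pphi i j) x v t.
  by have := d0 i j; rewrite !mxE.
have := flat_coef1 (flat_comp (peta k l) fphi) (p := (x k l)%:P + v k l *: 'X).
rewrite coefD coefC coefZ coefX add0r mulr1 mxE; apply=> t.
by rewrite etaK !mxE hornerD hornerC hornerZ hornerX mulrC.
Qed.

(* [f] is not differentiated: it preserves flatness of arcs. *)
Lemma collapsing_kernel c x v : diagonal c x -> collapsing m c v -> forall i u, (i < 3)%N ->
  \sum_k wt R m' k * (dot (phi x) k u ^+ i * dot (dphi x v) k u) = 0.
Proof.
move=> xc [vc sv] i u i3.
have [|h [ph hP]] := power_sum_epoint m' (i := i.+1) u (N := N).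
  by rewrite /= (leq_trans _ N5) // (leq_trans i3).
have fl : flat (fun t => h (epoint N m' (phi (x + t *: v)))).
  under eq_fun do rewrite phiE.
  apply: (flat_comp (h := fun y => h (f y)) (f := fun t => epoint N m (x + t *: v))).
    by apply: (polyfun_comp ph) => a j; rewrite (ord1 a).
  move=> a j; rewrite (ord1 a); apply: (flat_esym_point _ xc vc).
  by rewrite -[RHS]sv; apply: eq_bigr => k _; rewrite mxE.
pose L k := \sum_l u 0 l *: line (fun z => phi z k l) x v.
have := flat_coef1 fl (p := \sum_k wt R m' k *: L k ^+ i.+1).
rewrite coef_sum => H; apply: (mulIf (_ : i.+1%:R != 0)); first by rewrite Num.Theory.pnatr_eq0.
rewrite mul0r -[RHS]H => [|t].
  rewrite mulr_suml; apply: eq_bigr => k _.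
  rewrite coefZ coef1X /L !coef_sum -[in RHS]mulr_natr [RHS]mulrA; congr (_ * (_ ^+ _ * _) * _).
    by apply: eq_bigr => l _; rewrite coefZ line_coef0 // mulrC.
  by apply: eq_bigr => l _; rewrite coefZ mxE mulrC.
rewrite -hP horner_sum; apply: eq_bigr => k _; rewrite hornerZ horner_exp; congr (_ * _ ^+ _).
rewrite /L horner_sum; apply: eq_bigr => l _.
by rewrite hornerZ mulrC; congr (_ * _); apply: lineP.
Qed.

Definition collision (c : 'I_3) : M :=
  wt R m (c + 2) *: unit_row R n (c + 1) + (- wt R m (c + 1)) *: unit_row R n (c + 2).

Lemma collision_collapsing c : collapsing m c (collision c).
Proof.
have [n1 n2 n12] := ord3_neq c.
split; first by apply/rowP => l; rewrite !mxE (negbTE n1) (negbTE n2) !mulr0 addr0.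
rewrite (sum_ord3 _ c); apply/rowP => l; rewrite !mxE !eqxx (negbTE n1) (negbTE n2).
rewrite (negbTE n12) [c + 2 == _]eq_sym (negbTE n12) /=; ring.
Qed.

Lemma collision_neq0 c : collision c != 0.
Proof.
have [n1 n2 n12] := ord3_neq c.
apply/eqP => /matrixP /(_ (c + 1) (Ordinal n_gt0)); rewrite !mxE eqxx (negbTE n12).
by rewrite mulr1 mulr0 addr0; apply/eqP; rewrite Num.Theory.pnatr_eq0 -lt0n.
Qed.

Let wt'0 k : wt R m' k != 0.
Proof. by rewrite Num.Theory.pnatr_eq0 -lt0n. Qed.

(** The differential of [phi] is injective, so [collision c] gives a nonzero kernel vector at
    [phi x], which excludes three distinct rows. *)
Lemma phi_diagonal1 c x : diagonal c x -> exists d, diagonal d (phi x).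
Proof.
move=> xc; apply: contrapT => nd.
have ker := collapsing_kernel xc (collision_collapsing c).
have /dphi_inj0/eqP := kernel_distinct wt'0 ker (diagonalP nd).
by rewrite (negbTE (collision_neq0 c)).
Qed.

(** Irreducibility of the diagonal [c]: if it had a point sent off each diagonal [d], the three
    polynomials [h d] would be nonzero at a common point, against [phi_diagonal1]. *)
Lemma phi_diagonal c : exists d, forall x, diagonal c x -> diagonal d (phi x).
Proof.
apply: contrapT => H.
have /choice[y yP] : forall d, exists x, diagonal c x /\ ~ diagonal d (phi x).
  move=> d; apply: contrapT => nx; apply: H; exists d => x xc.
  by apply: contrapT => nd; apply: nx; exists x.
have /choice[l lP] : forall d, exists l, phi (y d) (d + 1) l - phi (y d) (d + 2) l != 0.
  move=> d; apply: contrapT => nl; apply: (yP d).2; apply/rowP => l; rewrite !mxE.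
  by apply/eqP; rewrite -subr_eq0; apply/negPn/negP => ne; apply: nl; exists l.
pose h d x := phi (to_diagonal c x) (d + 1) (l d) - phi (to_diagonal c x) (d + 2) (l d).
have [||x] := polyfun_prod_neq0 (index_enum 'I_3) (h := h).
- by move=> d; apply: polyfunB; apply: (polyfun_to_diagonal c (pphi _ _)).
- by move=> d; exists (y d); rewrite /h to_diagonal_id //; have [] := yP d.
move=> /prodf_neq0 hx; have [d /rowP /(_ (l d))] := phi_diagonal1 (to_diagonalP c x).
by rewrite !mxE => E; have := hx d isT; rewrite /h E subrr eqxx.
Qed.

Section Sigma.
Variable s : 'I_3 -> 'I_3.
Hypothesis sP : forall c x, diagonal c x -> diagonal (s c) (phi x).
Hypothesis s_inj : injective s.
Variable s' : 'I_3 -> 'I_3.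
Hypothesis s'P : forall c x, diagonal c x -> diagonal (s' c) (eta x).

Lemma dphi_diagonal c v : diagonal c v -> diagonal (s c) (dphi 0 v).
Proof.
move=> vc; apply/rowP => l; rewrite !mxE; congr (polyseq _)`_1; congr polyof.
apply: funext => t; have tvc : diagonal c (0 + t *: v).
  rewrite add0r /diagonal; apply/rowP => j; rewrite !mxE.
  by have /rowP/(_ j) := vc; rewrite !mxE => ->.
by have /rowP/(_ l) := sP tvc; rewrite !mxE.
Qed.

(** Otherwise [phi] would send the diagonal [c] into all three diagonals, and applying [eta] would
    put [unit_row c] on the diagonal [c + 1]. *)
Lemma phi_generic c : exists x, diagonal c x /\ row (s c) (phi x) != row (s c + 1) (phi x).
Proof.
apply: contrapT => H.
have all_diag x : diagonal c x -> forall d, diagonal d (phi x).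
  move=> xc; have E0 := sP xc.
  have E1 : row (s c) (phi x) = row (s c + 1) (phi x).
    by apply/eqP/negPn/negP => ne; apply: H; exists x.
  have [e01 e02 e11 e12 [e21 e22]] := ord3E.
  move: (s c) E0 E1; rewrite /diagonal.
  elim/ord3P; rewrite ?(e01, e02, e11, e12, e21, e22) => E0 E1;
    by elim/ord3P; rewrite ?(e01, e02, e11, e12, e21, e22) ?E1 ?E0.
have s's d : s' (s d) = d.
  apply/(diagonal_unit_row R n_gt0); rewrite -[unit_row _ _ _]etaK; apply/s'P/sP.
  exact/(diagonal_unit_row R n_gt0).
have : diagonal (c + 1) (unit_row R n c).
  rewrite -[unit_row _ _ _]etaK -[c + 1]s's; apply/s'P/all_diag.
  exact/(diagonal_unit_row R n_gt0).
move/(diagonal_unit_row R n_gt0) => E; have [] := ord3_neq c.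
by rewrite E eqxx.
Qed.

(** All rows of [phi 0] coincide, so at [0] only the weighted sum is available directly. The
    vanishing of row [s c] holds at points of the diagonal [c] where [phi] keeps row [s c] apart,
    and reaches [0] by density. *)
Lemma dphi_collision c : collapsing m' (s c) (dphi 0 (collision c)).
Proof.
have cc := collision_collapsing c; set v := collision c in cc *.
have d0 : diagonal c (0 : M) by rewrite /diagonal !row0.
split; last first.
  by apply: (kernel_weighted_sum (collapsing_kernel d0 cc)).
apply/rowP => l; apply/eqP; rewrite !mxE; apply/negPn/negP => nz.
have [y [yc /eqP ny]] := phi_generic c.
have [l' hy] : exists l', phi y (s c) l' - phi y (s c + 1) l' != 0.
  apply: contrapT => nl; apply: ny; apply/rowP => l'; rewrite !mxE.
  by apply/eqP; rewrite -subr_eq0; apply/negPn/negP => ne; apply: nl; exists l'.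
pose g x := phi (to_diagonal c x) (s c) l' - phi (to_diagonal c x) (s c + 1) l'.
pose h x := dphi (to_diagonal c x) v (s c) l.
have pg : polyfun g by apply: polyfunB; apply: (polyfun_to_diagonal c (pphi _ _)).
have ph : polyfun h.
  apply: (polyfun_to_diagonal c (h := fun x => dphi x v (s c) l)).
  by apply: eq_polyfun (polyfun_dline v (pphi (s c) l)) => x; rewrite mxE.
have [||z [gz hz]] := polyfun_domain pg ph (x := y) (y := 0).
- by rewrite /g to_diagonal_id.
- by rewrite /h to_diagonal_id // mxE.
have zc := to_diagonalP c z.
have := kernel_diagonal wt'0 (collapsing_kernel zc cc) (sP zc).
move=> /(_ _)/rowP/(_ l); rewrite !mxE => K.
move/negP: hz; apply; apply/eqP; rewrite /h mxE; apply: K.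
by apply: contra gz => /eqP/rowP/(_ l'); rewrite !mxE /g => ->; rewrite subrr.
Qed.

(** In a column, the images [Y] and [Z] of [unit_row (c + 1)] and [unit_row (c + 2)] are constant
    except for a jump at [s (c + 1)] and at [s (c + 2)] respectively. The two jumps are equal
    because the sum of the unit rows is on the diagonal [c]. The image of [collision c] vanishes at
    [s c], so its other entries are the common jump times [m (c + 2)] and [- m (c + 1)]; their sum
    weighted by [m'] is zero. *)
Lemma weights_proportional c :
  wt R m (c + 2) * wt R m' (s (c + 1)) = wt R m (c + 1) * wt R m' (s (c + 2)).
Proof.
have [n1 n2 n12] := ord3_neq c; have [ker0 kerS] := dphi_collision c.
have s1 : s c != s (c + 1) by rewrite (inj_eq s_inj).
have s2 : s c != s (c + 2) by rewrite (inj_eq s_inj).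
have s12 : s (c + 1) != s (c + 2) by rewrite (inj_eq s_inj).
have dY := dphi_diagonal (iffRL (diagonal_unit_row R n_gt0 (c + 1) _) erefl).
have dZ := dphi_diagonal (iffRL (diagonal_unit_row R n_gt0 (c + 2) _) erefl).
have dYZ : diagonal (s c) (dphi 0 (unit_row R n (c + 1)) + dphi 0 (unit_row R n (c + 2))).
  rewrite -[X in X + _]scale1r -dphi_linear; apply: dphi_diagonal.
  apply/rowP => l; rewrite !mxE !eqxx (negbTE n12) eq_sym (negbTE n12) /=; ring.
have dE : dphi 0 (collision c) = wt R m (c + 2) *: dphi 0 (unit_row R n (c + 1))
    + (- wt R m (c + 1)) *: dphi 0 (unit_row R n (c + 2)).
  have d00 : dphi 0 0 = 0.
    by have := dphi_linear 0 (-1) 0 0; rewrite scaler0 addr0 scaleN1r addNr.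
  rewrite /collision dphi_linear; congr (_ + _).
  by rewrite -[X in dphi 0 X]addr0 dphi_linear d00 addr0.
move: (dphi 0 (unit_row R n (c + 1))) (dphi 0 (unit_row R n (c + 2))) dY dZ dYZ dE.
move=> Y Z dY dZ dYZ dE; rewrite dE in ker0 kerS.
(* If the jump were zero in every column, the image of [collision c] would vanish, against the
   injectivity of the differential. *)
have [l Al] : exists l, Y (s (c + 1)) l - Y (s c) l != 0.
  apply: contrapT => nA; move/negP: (collision_neq0 c); apply; apply/eqP/(dphi_inj0 (x := 0)).
  rewrite dE; apply/matrixP => k l.
  have A0 : Y (s (c + 1)) l = Y (s c) l.
    by apply/eqP; rewrite -subr_eq0; apply/negPn/negP => ne; apply: nA; exists l.
  have Y0 : Y (s (c + 2)) l = Y (s c) l by apply: (diagonal_entry _ dY); rewrite // eq_sym.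
  have Z0 : Z (s (c + 1)) l = Z (s c) l by apply: (diagonal_entry _ dZ); rewrite // eq_sym.
  have YZ := diagonal_entry l dYZ s1 s2; rewrite !addmxE A0 Y0 Z0 in YZ.
  have K0 : wt R m (c + 2) * Y (s c) l + - wt R m (c + 1) * Z (s c) l = 0.
    by have /rowP/(_ l) := ker0; rewrite !mxE.
  rewrite addmxE !scalemxE [RHS]mxE.
  have Z2 : Z (s (c + 2)) l = Z (s c) l by exact/esym/(addrI _ YZ).
  have /codomP[i ->] := injF_onto s_inj k.
  by case/or3P: (ord3_cover c i) => /eqP->; rewrite ?A0 ?Y0 ?Z0 ?Z2 K0.
have YZ := diagonal_entry l dYZ s1 s2; rewrite !addmxE in YZ.
have Y0 : Y (s (c + 2)) l = Y (s c) l by apply: (diagonal_entry _ dY); rewrite // eq_sym.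
have Z0 : Z (s (c + 1)) l = Z (s c) l by apply: (diagonal_entry _ dZ); rewrite // eq_sym.
have K0 : wt R m (c + 2) * Y (s c) l + - wt R m (c + 1) * Z (s c) l = 0.
  by have /rowP/(_ l) := ker0; rewrite !mxE.
have : \sum_i wt R m' (s i) * (wt R m (c + 2) * Y (s i) l + - wt R m (c + 1) * Z (s i) l) = 0.
  have /rowP/(_ l) := kerS; rewrite summxE [RHS]mxE => E.
  rewrite -[RHS]E [RHS](reindex_inj s_inj) /=.
  by apply: eq_bigr => i _; rewrite !mxE.
rewrite (sum_ord3 _ c) K0 Y0 Z0 mulr0 add0r => KS.
apply/eqP; rewrite -subr_eq0; apply/eqP/(mulIf Al); rewrite mul0r -[RHS]KS.
have Zs : Z (s (c + 2)) l = Y (s (c + 1)) l + Z (s c) l - Y (s c) l.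
  by rewrite -[in RHS]Z0 YZ Y0; ring.
rewrite Zs; apply/eqP; rewrite -subr_eq0.
have -> : forall a b w1 w2 y1 y0 z0 : C,
    (w2 * a - w1 * b) * (y1 - y0)
      - (a * (w2 * y1 + - w1 * z0) + b * (w2 * y0 + - w1 * (y1 + z0 - y0)))
  = - (a + b) * (w2 * y0 + - w1 * z0) + 0 by move=> *; ring.
by rewrite K0 mulr0 addr0.
Qed.

End Sigma.
End Transport.

(** * From isomorphic fibers to proportional weights *)

Section Isomorphisms.
Variables (R : realType) (n N : nat).
Hypotheses (n_gt0 : (0 < n)%N) (N5 : (5 <= N)%N).
Local Notation C := R[i].
Local Notation M := 'M[C]_(3, n).

Lemma fiber_epoint (m : 'I_3 -> nat) y : (forall k, (0 < m k)%N) ->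
  fiber (@Delta3 R n N) (natpoint R m) y <-> exists x : M, y = epoint N m x.
Proof.
move=> m0; split=> [[m1 [v [_ [<- ->]]]]|[x ->]].
  exists (\matrix_k v k); congr esym_point.
  by apply: funext => k; rewrite /rows rowK.
by exists (natpoint R m), (rows x); split=> //; apply: natpoint_C3o.
Qed.

Lemma polyfun_regular_map (m : 'I_3 -> nat) k (f : 'I_k -> {mpoly C[#|symprod_basis n N|]}) j :
  polyfun (fun x : M => regular_map f (epoint N m x) 0 j).
Proof.
apply: (polyfun_comp (h := fun y => regular_map f y 0 j)) => [|a i].
  by apply: eq_polyfun (polyfun_meval (f j)) => y; rewrite mxE.
by rewrite (ord1 a); apply: polyfun_esym_point.
Qed.

Lemma isomorphic_weights (m m' : 'I_3 -> nat) :
  (forall k, (0 < m k)%N) -> injective m -> (forall k, (0 < m' k)%N) -> injective m' ->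
  isomorphic (fiber (@Delta3 R n N) (natpoint R m)) (fiber (@Delta3 R n N) (natpoint R m')) ->
  exists (s : 'S_3) (c : C), forall j, (m (s j))%:R = c * (m' j)%:R.
Proof.
move=> m0 m_inj m'0 m'_inj [f [g [fX gY fK gK]]].
have [phi [pphi phiE]] : exists phi : M -> M, (forall k l, polyfun (fun x => phi x k l)) /\
    forall x, epoint N m' (phi x) = regular_map f (epoint N m x).
  apply: (epoint_lift N5 m'0 m'_inj) => [j|x|x']; first exact: polyfun_regular_map.
    by apply/(fiber_epoint _ m'0)/fX/(fiber_epoint _ m0); exists x.
  have Yx' : fiber (@Delta3 R n N) (natpoint R m') (epoint N m' x').
    by apply/(fiber_epoint _ m'0); exists x'.
  have /(fiber_epoint _ m0)[x xE] := gY _ Yx'.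
  exists x; rewrite -xE; exact: gK.
have [eta [peta etaE]] : exists eta : M -> M, (forall k l, polyfun (fun x => eta x k l)) /\
    forall x, epoint N m (eta x) = regular_map g (epoint N m' x).
  apply: (epoint_lift N5 m0 m_inj) => [j|x|x']; first exact: polyfun_regular_map.
    by apply/(fiber_epoint _ m0)/gY/(fiber_epoint _ m'0); exists x.
  have Xx' : fiber (@Delta3 R n N) (natpoint R m) (epoint N m x').
    by apply/(fiber_epoint _ m0); exists x'.
  have /(fiber_epoint _ m'0)[x xE] := fX _ Xx'.
  exists x; rewrite -xE; exact: fK.
have etaK x : eta (phi x) = x.
  apply: (epoint_section N5 m0 m_inj (E := fun x => eta (phi x))) => [k l|z].
    by apply: (polyfun_comp (peta k l)).
  by rewrite etaE phiE fK //; apply/(fiber_epoint _ m0); exists z.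
have phiK x : phi (eta x) = x.
  apply: (epoint_section N5 m'0 m'_inj (E := fun x => phi (eta x))) => [k l|z].
    by apply: (polyfun_comp (pphi k l)).
  by rewrite phiE etaE gK //; apply/(fiber_epoint _ m'0); exists z.
have pf (a b : nat) (h : 'I_b -> {mpoly C[a]}) j : polyfun (fun y => regular_map h y 0 j).
  by apply: eq_polyfun (polyfun_meval (h j)) => y; rewrite mxE.
have /choice[s sP] := phi_diagonal n_gt0 N5 m0 m'0 (pf _ _ f) pphi peta phiE etaK.
have /choice[s' s'P] := phi_diagonal n_gt0 N5 m'0 m0 (pf _ _ g) peta pphi etaE phiK.
have s_inj : injective s.
  apply: (can_inj (g := s')) => d; apply/(diagonal_unit_row R n_gt0).
  rewrite -[unit_row _ _ _]etaK; apply/s'P/sP.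
  exact/(diagonal_unit_row R n_gt0).
have prop := weights_proportional n_gt0 N5 m0 m'0 (pf _ _ f) pphi peta phiE etaK sP s_inj s'P.
have nz k : wt R m' k != 0 by rewrite Num.Theory.pnatr_eq0 -lt0n.
(* The ratio of [m k] to [m' (s k)] is constant, whereas the conclusion permutes the indices of [m];
   hence the inverse. *)
pose p : 'S_3 := ((perm s_inj)^-1)%g.
have pK j : s (p j) = j by rewrite -(permE s_inj) permKV.
exists p, (wt R m 0 / wt R m' (s 0)) => j.
rewrite -[in RHS](pK j) -/(wt R m (p j)) -/(wt R m' (s (p j))); move: (p j) => k.
have [e01 e02 e11 e12 [e21 e22]] := ord3E.
apply: (mulIf (nz (s 0))); rewrite mulrAC divfK //; elim/ord3P: k => //.
  by have := prop 2; rewrite e21 e22.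
by have := prop 1; rewrite e11 e12 => ->.
Qed.

End Isomorphisms.

(** * Density of the triples of distinct positive integers *)

Section NaturalPoints.
Variable R : realType.
Local Notation C := R[i].

Let upd (x : 'rV[C]_3) l (a : C) : 'rV[C]_3 := \row_j (if j == l then a else x 0 j).

Lemma polyfun_nat_coord (h : 'rV[C]_3 -> C) x l : polyfun h -> h x != 0 ->
  exists k : nat, (0 < k)%N /\ h (upd x l k%:R) != 0.
Proof.
move=> ph hx; apply: contrapT => nk.
have lE t : upd x l 1 + t *: delta_mx 0 l = upd x l (1 + t).
  apply/rowP => j; rewrite !mxE eqxx /=.
  by case: eqP; rewrite ?mulr1 ?mulr0 ?addr0.
(* The line starts at coordinate 1, so that the parameter [k] corresponds to the positive integer
   [k.+1]. *)
have /eqP := lineP ph (upd x l 1) (delta_mx 0 l) (x 0 l - 1).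
rewrite (_ : line _ _ _ = 0); last first.
  apply: poly_nat_eq0 => k; rewrite -lineP // lE nat1r; apply: contrapT => /eqP hk.
  by apply: nk; exists k.+1.
rewrite lE horner0 addrC subrK (_ : upd x l (x 0 l) = x) ?(negbTE hx) //.
by apply/rowP => j; rewrite mxE; case: eqP => [->|].
Qed.

Lemma polyfun_natpoint (h : 'rV[C]_3 -> C) x : polyfun h -> h x != 0 ->
  exists m : 'I_3 -> nat, (forall k, (0 < m k)%N) /\ h (natpoint R m) != 0.
Proof.
move=> ph /(polyfun_nat_coord 0 ph)[a [a0 /(polyfun_nat_coord 1 ph)[b [b0]]]].
move=> /(polyfun_nat_coord 2 ph)[c [c0 hc]].
exists (fun j => if j == 0 then a else if j == 1 then b else c); split; first by elim/ord3P.
congr (h _ != 0): hc; apply/rowP => j; rewrite !mxE; move: j.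
by elim/ord3P.
Qed.

Lemma exists_weights (h : 'rV[C]_3 -> C) x : polyfun h -> h x != 0 ->
  exists m : 'I_3 -> nat, [/\ forall k, (0 < m k)%N, injective m & h (natpoint R m) != 0].
Proof.
move=> ph hx; pose d (y : 'rV[C]_3) := \prod_i (y 0 i - y 0 (i + 1)).
have pd : polyfun d by apply: polyfun_prod => i; apply: polyfunB; apply: polyfun_coord.
have d0 : d (natpoint R (fun k => k : nat)) != 0.
  apply/prodf_neq0 => i _; rewrite !mxE subr_eq0 Num.Theory.eqr_nat.
  by have [] := ord3_neq i.
have [y [hy dy]] := polyfun_domain ph pd hx d0.
have [m [m0]] := polyfun_natpoint (polyfunM ph pd) (mulf_neq0 hy dy).
rewrite mulf_eq0 negb_or => /andP[hm /prodf_neq0 dm]; exists m; split=> // i j.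
have {}dm k : m k != m (k + 1).
  by have := dm k isT; rewrite !mxE subr_eq0 Num.Theory.eqr_nat.
have [e01 e02 e11 e12 [e21 e22]] := ord3E.
have := dm 0; have := dm 1; have := dm 2; rewrite e01 e11 e21 => m2 m1 m0'.
by elim/ord3P: i; elim/ord3P: j => // /eqP; rewrite ?(negbTE m0') ?(negbTE m1) ?(negbTE m2)
  // eq_sym ?(negbTE m0') ?(negbTE m1) ?(negbTE m2).
Qed.

End NaturalPoints.

Theorem proposition5p13 (R : realType) (n : nat) (hn : (1 <= n)%N) :
  exists N0 : nat, forall N : nat, (N0 <= N)%N ->
    ~ isotrivial (@C3o R) (@Delta3 R n N) /\
    forall m m' : 'I_3 -> nat,
      (forall j, 0 < m j)%N -> injective m ->
      (forall j, 0 < m' j)%N -> injective m' ->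
      (forall (s : 'S_3) (c : R[i]),
         ~ forall j, (m (s j))%:R = c * (m' j)%:R) ->
      ~ isomorphic (fiber (@Delta3 R n N) (natpoint R m))
                   (fiber (@Delta3 R n N) (natpoint R m')).
Proof.
(* Five is the highest degree of a moment used in [power_sums_inj] and [polyfun_lift]. *)
exists 5%N => N N5.
have noniso m m' : (forall j, 0 < m j)%N -> injective m ->
    (forall j, 0 < m' j)%N -> injective m' ->
    (forall (s : 'S_3) (c : R[i]), ~ forall j, (m (s j))%:R = c * (m' j)%:R) ->
    ~ isomorphic (fiber (@Delta3 R n N) (natpoint R m)) (fiber (@Delta3 R n N) (natpoint R m')).
  move=> m0 m_inj m'0 m'_inj nprop iso.
  by have [s [c /nprop]] := isomorphic_weights hn N5 m0 m_inj m'0 m'_inj iso.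
split=> // -[U [[S ->] [P [_ [p Sp pP]]] iso]].
have pp := polyfun_meval p.
have [m [m0 m_inj pm]] := exists_weights pp pP.
(* If [m (s j) = c * m' j] for all [j], then [m (s 0) * m' 1 = m (s 1) * m' 0]; so where [q] is
   nonzero, no rearrangement of [m] is a multiple of the point. *)
pose q (x : 'rV[R[i]]_3) := \prod_i \prod_j ((m i)%:R * x 0 1 - (m j)%:R * x 0 0).
have pq : polyfun q.
  by do 2 apply: polyfun_prod => ?; apply: polyfunB; apply: polyfunM;
    first [exact: polyfun_cst | exact: polyfun_coord].
have q1 : q (delta_mx 0 1) != 0.
  apply/prodf_neq0 => i _; apply/prodf_neq0 => j _.
  by rewrite !mxE /= mulr1 mulr0 subr0 Num.Theory.pnatr_eq0 -lt0n.
have [x [px qx]] := polyfun_domain pp pq pP q1.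
have [m' [m'0 m'_inj]] := exists_weights (polyfunM pp pq) (mulf_neq0 px qx).
rewrite mulf_eq0 negb_or => /andP[pm' /prodf_neq0 qm'].
apply: (noniso m m') => // [s c prop|]; last first.
  by apply: iso; split; [exact: natpoint_C3o | exists p | exact: natpoint_C3o | exists p].
have /prodf_neq0/(_ (s 1) isT)/negP := qm' (s 0) isT; apply.
by rewrite !prop !mxE subr_eq0; apply/eqP; ring.
Qed.
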